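(* Assume $X_0=\mathcal{Z}(a,E)$ and $U=\mathcal{Z}(c,G)$, where $a\in\mathbb{R}^n$, $c\in\mathbb{R}^m$, $E\in\mathbb{R}^{n\times p}$, $G\in\mathbb{R}^{m\times q}$ and $p,q\in\mathbb{Z}_+$. For each $N\in\mathbb{N}$, let $h=h^N=(t_f-t_0)/N$, $t_i=t^N_i=t_0+ih$ for $i\in\{0,\dots,N\}$, and define (superscripts $N$ suppressed) $b_0=a$, $F_0=E$ and, recursively for $i\in\{1,\dots,N\}$, $$m_{i-1}=\|(b_{i-1},F_{i-1})\|_\infty,\qquad K_i=hB(t_i)G,$$ $$b_i=\widetilde\phi(t_i,t_{i-1})b_{i-1}+hB(t_i)c,$$ $$F_i=\big(\widetilde\phi(t_i,t_{i-1})F_{i-1},\ K_i,\ (\alpha(h)+\theta(h)m_{i-1})\,\mathrm{id}\big),$$ $$(d_i,J_i)=\mathcal{E}\big((b_{i-1},F_{i-1}),\ (b_i,\widetilde\phi(t_i,t_{i-1})F_{i-1})\big),$$ $$H_i=\big(J_i,\ K_i,\ (\alpha(h)+\beta(h)+(\gamma(h)+\theta(h))m_{i-1})\,\mathrm{id}\big),$$ and denote $\Lambda^N_i=\mathcal{Z}(d^N_i,H^N_i)$ and $\widehat R_N=\bigcup_{i=1}^N\Lambda^N_i$. Then $\mathcal{R}([t_0,t_f])\subseteq\widehat R_N$ for all $N\in\mathbb{N}$, and $d_H(\mathcal{R}([t_0,t_f]),\widehat R_N)=O(1/N)$ as $N\to\infty$.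
   Context: Notation. $\mathbb{N}=\{1,2,\dots\}$, $\mathbb{Z}_+=\{0,1,2,\dots\}$, $\mathbb{R}_+=[0,\infty)$. All vector spaces $\mathbb{R}^k$ carry the maximum norm $\|x\|_\infty=\max_i|x_i|$, and matrices carry the induced operator norm (maximal absolute row sum); both are written $\|\cdot\|$ or $\|\cdot\|_\infty$. $\mathbb{B}\subseteq\mathbb{R}^n$ is the closed unit ball; $\|M\|=\sup_{x\in M}\|x\|$ for a nonempty set $M$; operations on sets are pointwise (Minkowski). $\mathrm{id}$ is the $n\times n$ identity matrix; $(M_1,M_2,\dots)$ denotes horizontal concatenation of matrices/column vectors with $n$ rows. The Hausdorff distance of nonempty bounded sets is $d_H(\Omega,\Gamma)=\inf\{\varepsilon>0:\Omega\subseteq\Gamma+\varepsilon\mathbb{B},\ \Gamma\subseteq\Omega+\varepsilon\mathbb{B}\}$. Zonotopes. For $c\in\mathbb{R}^k$, $G\in\mathbb{R}^{k\times q}$, $q\in\mathbb{Z}_+$: $\mathcal{Z}(c,G)=c+G[-1,1]^q$. The enclosure operator is, for $b,c\in\mathbb{R}^n$ and $F,G\in\mathbb{R}^{n\times p}$, $$\mathcal{E}((b,F),(c,G))=\Big(\tfrac{b+c}{2},\ \big(\tfrac{F+G}{2},\tfrac{b-c}{2},\tfrac{F-G}{2}\big)\Big)\in\mathbb{R}^n\times\mathbb{R}^{n\times(2p+1)}.$$ System and standing assumptions. $n,m\in\mathbb{N}$, $t_0<t_f$ real. $X_0\subseteq\mathbb{R}^n$ and $U\subseteq\mathbb{R}^m$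 are the uncertainty sets (nonempty, compact, convex). $A:[t_0,t_f]\to\mathbb{R}^{n\times n}$ and $B:[t_0,t_f]\to\mathbb{R}^{n\times m}$ are of class $C^1$, and $\|A(t)\|\le M_A$, $\|\dot A(t)\|\le M_{\dot A}$, $\|B(t)\|\le M_B$, $\|\dot B(t)\|\le M_{\dot B}$ for all $t\in[t_0,t_f]$, with real constants and $M_A>0$. The system is $\dot x(t)=A(t)x(t)+B(t)u(t)$. For $s\in[t_0,t_f]$, $p\in\mathbb{R}^n$ and integrable $u$, $\varphi(\cdot,s,p,u)$ is its unique absolutely continuous solution on $[t_0,t_f]$ (the equation holding for almost every $t$) with value $p$ at time $s$; $\phi(t,s)\in\mathbb{R}^{n\times n}$ is the transition matrix, $\phi(t,s)p=\varphi(t,s,p,0)$. Let $D=\{(t,s)\in[t_0,t_f]^2: t\ge s\}$. There are given a map $\widetilde\phi:D\to\mathbb{R}^{n\times n}$ and a monotonically increasing $\theta:\mathbb{R}_+\to\mathbb{R}_+$ with $\|\phi(t,s)-\widetilde\phi(t,s)\|\le\theta(t-s)$ for all $(t,s)\in D$ and $\theta(h)=O(h^2)$ as $h\to0$. Reachable sets and tubes. $\mathcal{R}(t)=\{\varphi(t,t_0,x_0,u): x_0\in X_0,\ u:[t_0,t]\to U\text{ measurable}\}$ and $\mathcal{R}([a,b])=\bigcup_{s\in[a,b]}\mathcal{R}(s)$ for $t_0\le a\le b\le t_f$. Auxiliary functions on $\mathbb{R}_+$: $r(s)=\exp(sM_A)-1-sM_A$, $\ \alpha(s)=r(s)\|U\|\dfrac{M_{\dot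 B}+M_AM_B}{M_A^2}$, $\ \beta(s)=s^2M_{\dot B}\|U\|$, $\ \gamma(s)=r(s)\Big(1+\dfrac{M_{\dot A}}{M_A^2}\Big)$. *)

(* Defs.v *)
From mathcomp Require Import all_boot all_order all_algebra.
From mathcomp Require Import all_classical all_reals all_analysis.
From mathcomp Require Import measurable_realfun.

Set Implicit Arguments.
Unset Strict Implicit.
Unset Printing Implicit Defensive.

Import Order.TTheory GRing.Theory Num.Theory.
Import numFieldNormedType.Exports.

Local Open Scope classical_set_scope.
Local Open Scope ring_scope.

(* Vectors are column vectors 'cV[R]_k, and on them the library norm `|x| is
   the maximum norm. On general matrices `|M| is the entrywise maximum, which is
   NOT the operator norm; the operator norm is [opnorm]. *)
Section Norms.
Context {R : realType}.

Definition opnorm {k l : nat} (M : 'M[R]_(k, l)) : R :=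
  \big[Order.max/0]_(i < k) \sum_(j < l) `|M i j|.

Definition set_norm {k : nat} (S : set 'cV[R]_k) : R :=
  sup [set `|x| | x in S].

Definition unit_ball {k : nat} : set 'cV[R]_k := [set x | `|x| <= 1].

Definition fatten {k : nat} (S : set 'cV[R]_k) (e : R) : set 'cV[R]_k :=
  [set x + e *: y | x in S & y in unit_ball].

(* As usual this is meaningful for nonempty bounded sets (for unbounded ones the
   set of admissible radii may be empty). *)
Definition hausdorff_dist {k : nat} (S T : set 'cV[R]_k) : R :=
  inf [set e | [/\ 0 < e, S `<=` fatten T e & T `<=` fatten S e]].

Definition zonotope {k q : nat} (c : 'cV[R]_k) (G : 'M[R]_(k, q)) :
    set 'cV[R]_k :=
  [set c + G *m x | x in [set x : 'cV[R]_q | forall i, -1 <= x i 0 <= 1]].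

Definition enclosure {n p : nat} (bF cG : 'cV[R]_n * 'M[R]_(n, p)) :
    'cV[R]_n * 'M[R]_(n, p + (1 + p)) :=
  let: (b, F) := bF in let: (c, G) := cG in
  (2^-1 *: (b + c),
   row_mx (2^-1 *: (F + G)) (row_mx (2^-1 *: (b - c)) (2^-1 *: (F - G)))).

End Norms.

Section Regularity.
Context {R : realType} {V : normedModType R}.

(* f' is the derivative of f on [a, b], one-sided at the end points *)
Definition has_deriv_on (a b : R) (f f' : R -> V) : Prop :=
  forall t : R, t \in `[a, b] ->
    (fun s => (s - t)^-1 *: (f s - f t)) @ within `[a, b] t^' --> f' t.

Definition C1_on (a b : R) (f f' : R -> V) : Prop :=
  has_deriv_on a b f f' /\ {within `[a, b], continuous f'}.

Definition absolutely_continuous_on (a b : R) (f : R -> V) : Prop :=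
  forall e : R, 0 < e -> exists2 d : R, 0 < d &
    forall (k : nat) (l r : 'I_k -> R),
      (forall i, [/\ a <= l i, l i <= r i & r i <= b]) ->
      trivIset setT (fun i => `]l i, r i[%classic) ->
      \sum_(i < k) (r i - l i) < d ->
      \sum_(i < k) `|f (r i) - f (l i)| < e.

End Regularity.

(* Functions on a real interval are represented by total functions on R of which
   only the values on that interval matter. *)
Section System.
Context {R : realType} {n m : nat}.

(* measurability with respect to the Lebesgue sigma-algebra (the library's
   default sigma-algebra on R is the Borel one) *)
Definition lebesgue_measurable_fun (D : set R) (f : R -> R) : Prop :=
  measurable_fun
    (D : set (g_sigma_algebraType (completed_algebra_gen (@lebesgue_measure R))))
    f.

(* x = phi(., s, p, u) on [a, b]. At almost every t of [a, b] the two-sided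
   derivative is meant; the end points form a null set. *)
Definition is_solution (A : R -> 'M[R]_n) (B : R -> 'M[R]_(n, m)) (a b : R)
    (s : R) (p : 'cV[R]_n) (u : R -> 'cV[R]_m) (x : R -> 'cV[R]_n) : Prop :=
  [/\ absolutely_continuous_on a b x,
      x s = p &
      {ae @lebesgue_measure R, forall t : R, t \in `[a, b] ->
         is_derive t 1 x (A t *m x t + B t *m u t)}].

Definition is_transition_matrix (A : R -> 'M[R]_n) (B : R -> 'M[R]_(n, m))
    (t0 tf : R) (phi : R -> R -> 'M[R]_n) : Prop :=
  forall s : R, s \in `[t0, tf] -> forall p : 'cV[R]_n,
    is_solution A B t0 tf s p (fun=> 0) (fun t => phi t s *m p).

Definition admissible_input (U : set 'cV[R]_m) (a b : R)
    (u : R -> 'cV[R]_m) : Prop :=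
  (forall s : R, s \in `[a, b] -> U (u s)) /\
  (forall j, lebesgue_measurable_fun `[a, b] (fun s => u s j 0)).

Definition reach (A : R -> 'M[R]_n) (B : R -> 'M[R]_(n, m)) (t0 : R)
    (X0 : set 'cV[R]_n) (U : set 'cV[R]_m) (t : R) : set 'cV[R]_n :=
  [set y | exists x0 u x, [/\ X0 x0, admissible_input U t0 t u,
     is_solution A B t0 t t0 x0 u x & y = x t]].

Definition reach_tube (A : R -> 'M[R]_n) (B : R -> 'M[R]_(n, m)) (t0 : R)
    (X0 : set 'cV[R]_n) (U : set 'cV[R]_m) (a b : R) : set 'cV[R]_n :=
  \bigcup_(s in `[a, b]) reach A B t0 X0 U s.

End System.

Section Algorithm.
Context {R : realType} {n m p q : nat}.
Variables (t0 tf : R) (B : R -> 'M[R]_(n, m)) (phit : R -> R -> 'M[R]_n).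
Variables (theta : R -> R) (MA MdA MB MdB : R) (U : set 'cV[R]_m).
Variables (a : 'cV[R]_n) (E : 'M[R]_(n, p)) (c : 'cV[R]_m) (G : 'M[R]_(m, q)).

Definition aux_r (s : R) : R := expR (s * MA) - 1 - s * MA.
Definition aux_alpha (s : R) : R :=
  aux_r s * set_norm U * ((MdB + MA * MB) / MA ^+ 2).
Definition aux_beta (s : R) : R := s ^+ 2 * MdB * set_norm U.
Definition aux_gamma (s : R) : R := aux_r s * (1 + MdA / MA ^+ 2).

Variable N : nat.

Definition step : R := (tf - t0) / N%:R.
Definition node (i : nat) : R := t0 + i%:R * step.

Definition trans_step (i : nat) : 'M[R]_n := phit (node i) (node i.-1).
Definition K_mx (i : nat) : 'M[R]_(n, q) := step *: (B (node i) *m G).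

(* number of columns of F_i *)
Fixpoint F_cols (i : nat) : nat :=
  if i is j.+1 then F_cols j + (q + n) else p.

(* the pair (b_i, F_i) *)
Fixpoint bF (i : nat) : 'cV[R]_n * 'M[R]_(n, F_cols i) :=
  match i with
  | 0 => (a, E)
  | j.+1 =>
    let: (b, F) := bF j in
    (trans_step j.+1 *m b + step *: (B (node j.+1) *m c),
     row_mx (trans_step j.+1 *m F)
       (row_mx (K_mx j.+1)
          (aux_alpha step + theta step * opnorm (row_mx b F))%:M))
  end.

Definition m_norm (i : nat) : R := opnorm (row_mx (bF i).1 (bF i).2).

(* the pairs (d_i, J_i) and (d_i, H_i), for 1 <= i *)
Definition dJ (i : nat) :=
  enclosure (bF i.-1) ((bF i).1, trans_step i *m (bF i.-1).2).

Definition H_mx (i : nat) :=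
  row_mx (dJ i).2
    (row_mx (K_mx i)
       (aux_alpha step + aux_beta step
        + (aux_gamma step + theta step) * m_norm i.-1)%:M).

Definition Lambda (i : nat) : set 'cV[R]_n := zonotope (dJ i).1 (H_mx i).

Definition R_hat : set 'cV[R]_n :=
  \bigcup_(i in [set i | (1 <= i <= N)%N]) Lambda i.

End Algorithm.

(* Main.v *)
Require Import Defs.
From mathcomp Require Import all_boot all_order all_algebra.
From mathcomp Require Import all_classical all_reals all_analysis.
From mathcomp Require Import measurable_realfun ring lra.

Set Implicit Arguments.
Unset Strict Implicit.
Unset Printing Implicit Defensive.

Import Order.TTheory GRing.Theory Num.Theory.
Import numFieldNormedType.Exports.

Local Open Scope classical_set_scope.
Local Open Scope ring_scope.

(** Everything rests on one principle, [diff_inclusion]: if f is absolutely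
    continuous and almost everywhere f' lies in a fixed zonotope up to an error
    p(t), then the increment of f over [a, b] lies in (b - a) times this zonotope
    up to the integral of p. It is proved without integration theory. On short
    intervals around a point of differentiability the claim is clear; the null
    set of bad points is covered by an open set in which f has small variation;
    Cousin's lemma ([cousin]) assembles the pieces, and compactness of the ball of
    coordinates removes the small errors. Gronwall's inequality ([gronwall])
    follows.

    Containment. Over one grid cell [s, T] a trajectory is phi(t, s) x(s) plus a
    part w that starts at 0. By Gronwall w has velocity B(T) u(t) up to an
    explicit error, hence w(t) lies in (t - s) B(T) U up to alpha + beta
    ([input_estimate]). The homogeneous part is compared with its linear
    interpolation by first order expansions around t, which gives exactly gamma
    ([phi_taylor], [phi_interpolation]), and the enclosure operator contains the
    interpolating segments ([enclosure_segment]). Induction over the nodes gives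
    [node_state_in] and [reach_tube_subset].

    Convergence. A point of the zonotope at node i is given by generator
    coordinates, and these are the data of an initial state and of a piecewise
    constant input. The corresponding trajectory exists by variation of constants
    ([pw_solution]), and it stays within O(h) of the point because each step adds
    an error O(h^2) ([node_point_tracked]); for this the norms m_i have to be
    bounded independently of N ([m_norm_bounded]). Between two nodes the enclosure
    only adds O(h) ([Lambda_near]). Hence every point of the enclosure is O(1/N)
    close to the tube ([R_hat_near_tube]), and with the containment this bounds
    the Hausdorff distance. *)

(** * Gauge partitions and absolutely continuous functions *)

Section Gauge.
Context {R : realType}.

(** Cousin's lemma as an induction principle on intervals: additivity propagates Q
    past the supremum of the points t with Q a t, so this supremum is b. *)
Lemma cousin (a b : R) (Q : R -> R -> Prop) : a <= b ->
  (forall s t r, a <= s -> s <= t -> t <= r -> r <= b ->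
     Q s t -> Q t r -> Q s r) ->
  (forall t, a <= t -> t <= b -> exists2 d, 0 < d & forall s r,
     a <= s -> s <= t -> t <= r -> r <= b -> t - s < d -> r - t < d -> Q s r) ->
  Q a b.
Proof.
move=> ab Qadd Qloc.
pose S := [set t | a <= t <= b /\ Q a t].
have Sa : S a.
  split; first by rewrite lexx ab.
  by have [d d0 H] := Qloc a (lexx a) ab; apply: H; rewrite ?subrr.
have ubS : ubound S b by move=> t [/andP[_ ?] _].
have hS : has_sup S by split; [exists a | exists b].
have aT : a <= sup S by apply: sup_ubound => //; exists b.
have Tb : sup S <= b by apply: ge_sup => //; exists a.
have [d d0 H] := Qloc _ aT Tb.
have [t [/andP[at_ tb] Qt] tT] := sup_adherent d0 hS.
have tS : t <= sup S by apply: sup_ubound => //; [exists b | split=> //; apply/andP].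
pose r := Num.min b (sup S + d / 2).
have rb : r <= b by rewrite ge_min lexx.
have Tr : sup S <= r by rewrite le_min Tb /= lerDl; lra.
have rT : r <= sup S + d / 2 by rewrite ge_min lexx orbT.
have Qr : Q a r.
  apply: (Qadd _ t) => //; first exact: le_trans Tr.
  by apply: H => //; lra.
have Sr : S r by split=> //; apply/andP; split=> //; exact: le_trans Tr.
have rS : r <= sup S by apply: sup_ubound => //; exists b.
suff <- : r = b by [].
have := rS; rewrite {1}/r ge_min; case/orP => [bS|]; last by lra.
by apply/eqP; rewrite eq_le rb (le_trans bS Tr).
Qed.

(** Finite families of non-overlapping closed intervals of [a, b] inside O,
    listed from left to right; the definition is recursive so that families over
    adjacent intervals can be concatenated. *)
Fixpoint chain (O : set R) (a b : R) (L : seq (R * R)) : Prop :=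
  if L is J :: L' then
    [/\ a <= J.1, J.1 <= J.2, (forall x, J.1 <= x <= J.2 -> O x)
      & chain O J.2 b L']
  else a <= b.

Lemma chain_le O a b L : chain O a b L -> a <= b.
Proof.
elim: L a => [//|J L IH] a /= [aI I12 _ /IH Ib].
exact: le_trans aI (le_trans I12 Ib).
Qed.

Lemma chain_widen O a a' b L : a' <= a -> chain O a b L -> chain O a' b L.
Proof.
by case: L => [|J L] /= aa'; [exact: le_trans|case=> aI *; split=> //; exact: le_trans aI].
Qed.

Lemma chain_cat O a b c L1 L2 :
  chain O a b L1 -> chain O b c L2 -> chain O a c (L1 ++ L2).
Proof.
elim: L1 a => [|J L IH] a /=; first by move=> ab; apply: chain_widen.
by case=> aI I12 IO /IH H /H.
Qed.

Lemma chain_nth O a b L i : chain O a b L -> (i < size L)%N ->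
  [/\ a <= (nth (a, a) L i).1, (nth (a, a) L i).1 <= (nth (a, a) L i).2
    & (nth (a, a) L i).2 <= b].
Proof.
move: i; elim: L a => [//|J L IH] a [|i] /= [aI I12 _ Lb] iL.
  by split=> //; exact: chain_le Lb.
have [] := IH _ i Lb iL; rewrite (set_nth_default (a, a)) // => H1 H2 H3.
by split=> //; apply: le_trans H1; exact: le_trans I12.
Qed.

Lemma chain_nth_lt O a b L i j : chain O a b L -> (i < j)%N -> (j < size L)%N ->
  (nth (a, a) L i).2 <= (nth (a, a) L j).1.
Proof.
move: i j; elim: L a => [//|J L IH] a [|i] [|j] //= [aI I12 _ Lb] ij jL.
  by have [] := chain_nth Lb jL; rewrite (set_nth_default (a, a)).
have := IH _ i j Lb ij jL.
by rewrite !(set_nth_default (a, a) (J.2, J.2)) //; exact: ltn_trans ij jL.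
Qed.

Lemma chain_length_le O a b L : open O -> chain O a b L ->
  ((\sum_(J <- L) (J.2 - J.1))%:E <=
    @lebesgue_measure R (O `&` `[a, +oo[%classic))%E.
Proof.
move=> oO; have mO : measurable O by exact: open_measurable.
elim: L a => [|J L IH] a /=; first by rewrite big_nil => _; exact: measure_ge0.
case=> aI I12 IO Lb; rewrite big_cons EFinD.
have -> : (J.2 - J.1)%:E = lebesgue_measure `[J.1, J.2[%classic.
  rewrite lebesgue_measure_itv /= lte_fin; case: ltgtP I12 => // -> _.
  by rewrite subrr.
apply: (@le_trans _ _ (lebesgue_measure (`[J.1, J.2[%classic `|` (O `&` `[J.2, +oo[%classic)))).
  rewrite measureU //; first by rewrite leeD2l // IH.
    exact: measurableI.
  apply/seteqP; split=> x //= [] /=; rewrite !in_itv /= andbT => /andP[_ xI] [_].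
  by rewrite leNgt xI.
apply: le_measure; rewrite ?inE.
- by apply: measurableU => //; exact: measurableI.
- exact: measurableI.
- move=> x [|[]] /=; rewrite !in_itv /= ?andbT.
    move=> /andP[Ix xI]; split; first by apply: IO; rewrite Ix ltW.
    exact: le_trans Ix.
  move=> Ox Ix; split=> //.
  by apply: le_trans Ix; apply: le_trans I12.
Qed.

Context {V : normedModType R}.

(** The hypothesis on the exceptional set E under which f can be recovered from
    its derivative outside E: E has neighbourhoods on which both the variation
    of f and the length are arbitrarily small. *)
Definition small_variation (E : set R) (a b : R) (f : R -> V) : Prop :=
  forall e, 0 < e -> exists O, [/\ open O, E `<=` O & forall L, chain O a b L ->
    \sum_(J <- L) (`|f J.2 - f J.1| + (J.2 - J.1)) <= e].

Lemma small_variation_set0 a b f : small_variation set0 a b f.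
Proof.
move=> e e0; exists set0; split => //.
case=> [|J L] /=; first by rewrite big_nil => _; exact: ltW.
by case=> _ I12 IO _; case: (IO J.1); rewrite lexx.
Qed.

Lemma chain_variation O a b L (f : R -> V) e d : open O ->
  chain O a b L ->
  (forall (k : nat) (l r : 'I_k -> R),
      (forall i, [/\ a <= l i, l i <= r i & r i <= b]) ->
      trivIset setT (fun i => `]l i, r i[%classic) ->
      \sum_(i < k) (r i - l i) < d ->
      \sum_(i < k) `|f (r i) - f (l i)| < e) ->
  (lebesgue_measure O < d%:E)%E -> \sum_(J <- L) `|f J.2 - f J.1| < e.
Proof.
move=> oO cL fd Od.
rewrite (big_nth (a, a)) big_mkord; apply: fd.
- by move=> i; apply: chain_nth cL _.
- apply/trivIsetP => i j _ _.
  wlog ij : i j / (i < j)%N.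
    move=> H ij; case: (ltngtP i j) => [ij'|ji|/val_inj ij']; first exact: H.
    - by rewrite setIC H // eq_sym.
    - by rewrite ij' eqxx in ij.
  move=> _; apply/seteqP; split=> x //= []; rewrite !in_itv /=.
  move=> /andP[_ xi] /andP[jx _].
  have := chain_nth_lt cL ij (ltn_ord j).
  by rewrite leNgt (lt_trans jx xi).
- rewrite -(big_mkord xpredT (fun i => (nth (a, a) L i).2 - (nth (a, a) L i).1)).
  rewrite -(big_nth (a, a) xpredT (fun J => J.2 - J.1)).
  rewrite -lte_fin; apply: le_lt_trans Od; apply: le_trans (chain_length_le oO cL) _.
  apply: le_measure; rewrite ?inE.
  + by apply: measurableI => //; exact: open_measurable.
  + exact: open_measurable.
  + exact: subIsetl.
Qed.

(** By outer regularity a null set has open neighbourhoods of small measure, and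
    the measure dominates the total length of non-overlapping intervals. *)
Lemma small_variation_ac E a b f :
  absolutely_continuous_on a b f -> (@lebesgue_measure R).-negligible E ->
  small_variation E a b f.
Proof.
move=> fac [N [mN N0 EN]] e e0.
have [d d0 fd] := fac (e / 2) (divr_gt0 e0 (ltr0Sn _ _)).
pose d' := Num.min d (e / 2).
have d'0 : 0 < d' by rewrite lt_min d0 divr_gt0.
have [W [oW NW Wd]] : exists U : set R,
    [/\ open U, N `<=` U & (lebesgue_measure (U `\` N) < d'%:E)%E].
  by apply: lebesgue_regularity_outer => //; rewrite [X in (X < _)%E]N0 ltry.
have {}Wd : (lebesgue_measure W < d'%:E)%E.
  suff -> : lebesgue_measure W = lebesgue_measure (W `\` N) by [].
  have mW : measurable W by exact: open_measurable.
  rewrite (measureDI lebesgue_measure mW mN).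
  rewrite [X in (_ + X)%E](_ : _ = 0%E) ?adde0 //.
  apply/eqP; rewrite eq_le measure_ge0 andbT.
  rewrite -[X in (_ <= X)%E]N0; apply: le_measure; rewrite ?inE //.
    exact: measurableI.
exists W; split=> //; first exact: subset_trans NW.
move=> L cL; rewrite big_split /=.
have H1 : \sum_(J <- L) `|f J.2 - f J.1| < e / 2.
  apply: (chain_variation oW cL fd); apply: lt_le_trans Wd _.
  by rewrite lee_fin ge_min lexx.
have H2 : \sum_(J <- L) (J.2 - J.1) < e / 2.
  rewrite -lte_fin; apply: le_lt_trans (chain_length_le oW cL) _.
  apply: (@le_lt_trans _ _ (lebesgue_measure W)).
    apply: le_measure; rewrite ?inE.
    + by apply: measurableI => //; exact: open_measurable.
    + exact: open_measurable.
    + exact: subIsetl.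
  by apply: lt_le_trans Wd _; rewrite lee_fin ge_min lexx orbT.
by lra.
Qed.

End Gauge.

(** * Norms of vectors and matrices *)

Section VectorNorms.
Context {R : realType}.

Lemma cV_norm_leP k (v : 'cV[R]_k) (c : R) : 0 <= c ->
  (`|v| <= c) <-> (forall i, `|v i 0| <= c).
Proof.
move=> c0; rewrite [`|v|]mx_normrE; split.
  by move=> /bigmax_leP[_ H] i; exact: (H (i, 0) isT).
by move=> H; apply/bigmax_leP; split=> // -[i j] _ /=; rewrite (ord1 j).
Qed.

Lemma cV_entry_le k (v : 'cV[R]_k) i : `|v i 0| <= `|v|.
Proof. by have /cV_norm_leP : `|v| <= `|v| by []; exact. Qed.

Lemma opnorm_ge0 k l (M : 'M[R]_(k, l)) : 0 <= opnorm M.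
Proof. by rewrite /opnorm; apply/bigmax_geP; left. Qed.

Lemma mulmx_norm_le k l (M : 'M[R]_(k, l)) (v : 'cV[R]_l) :
  `|M *m v| <= opnorm M * `|v|.
Proof.
apply/cV_norm_leP => [|i]; first by rewrite mulr_ge0 ?opnorm_ge0.
rewrite mxE; apply: (@le_trans _ _ ((\sum_j `|M i j|) * `|v|)).
  rewrite mulr_suml; apply: le_trans (ler_norm_sum _ _ _) _.
  by apply: ler_sum => j _; rewrite normrM ler_wpM2l // cV_entry_le.
by rewrite ler_wpM2r // /opnorm; apply/bigmax_geP; right; exists i.
Qed.

(** The sign vector of a row realises the absolute row sum. *)
Lemma opnorm_le k l (M : 'M[R]_(k, l)) (c : R) : 0 <= c ->
  (forall v : 'cV[R]_l, `|v| <= 1 -> `|M *m v| <= c) -> opnorm M <= c.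
Proof.
move=> c0 H; rewrite /opnorm; apply/bigmax_leP; split=> // i _.
pose v : 'cV[R]_l := \col_j Num.sg (M i j).
have v1 : `|v| <= 1.
  apply/cV_norm_leP => // j; rewrite mxE normr_sg.
  by case: (_ == _).
have := H v v1 => /(le_trans (cV_entry_le _ i)).
apply: le_trans; rewrite mxE; apply: le_trans (ler_norm _).
by apply: ler_sum => j _; rewrite mxE mulrC -normrEsg.
Qed.

Lemma zonotopeP k q (c : 'cV[R]_k) (G : 'M[R]_(k, q)) y :
  zonotope c G y <-> exists2 x, `|x| <= 1 & y = c + G *m x.
Proof.
split=> [[x /= x1 <-]|[x x1 ->]].
  exists x => //; apply/cV_norm_leP => // i; rewrite ler_norml; exact: x1.
by exists x => //= i; rewrite -ler_norml; exact: le_trans (cV_entry_le _ _) x1.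
Qed.

Lemma tr_norm k (v : 'rV[R]_k) : `|v^T| = `|v|.
Proof.
apply/eqP; rewrite eq_le; apply/andP; split.
  apply/cV_norm_leP => // i; rewrite mxE [leRHS]mx_normrE.
  by apply/bigmax_geP; right; exists (0, i).
rewrite [leLHS]mx_normrE; apply/bigmax_leP; split=> // -[j i] _ /=.
by rewrite (ord1 j); have := cV_entry_le v^T i; rewrite mxE.
Qed.

(** Compactness of the ball turns approximate solvability into solvability. *)
Lemma ball_image_closed k q (L : 'M[R]_(k, q)) (w : 'cV[R]_k) (rho c : R) :
  0 <= rho ->
  (forall e, 0 < e -> exists2 x, `|x| <= rho & `|w - L *m x| <= c + e) ->
  exists2 x, `|x| <= rho & `|w - L *m x| <= c.
Proof.
move=> rho0 H.
pose K := [set v : 'rV[R]_q | forall i, `[-rho, rho]%classic (v ord0 i)].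
pose F (v : 'rV[R]_q) := `|w - L *m v^T|.
have cK : compact K.
  by apply: (@rV_compact _ _ (fun=> `[-rho, rho]%classic)) => i; exact: segment_compact.
have KP v : K v <-> `|v| <= rho.
  rewrite -tr_norm; split=> [Kv|/cV_norm_leP Kv i].
    apply/cV_norm_leP => // i; rewrite mxE ler_norml.
    by have := Kv i; rewrite /= in_itv.
  by rewrite /= in_itv /= -ler_norml; have := Kv rho0 i; rewrite mxE.
have cF : continuous F.
  move=> v; apply/(@cvgrPdist_le _ _ _ (nbhs v) (nbhs_filter v)) => /= e e0.
  have e1 : 0 < e / (opnorm L + 1).
    by rewrite divr_gt0 // ltr_wpDl // opnorm_ge0.
  apply/nbhs_ballP; exists (e / (opnorm L + 1)) => // v'.
  rewrite -ball_normE /= => /ltW vv'.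
  apply: le_trans (ler_dist_dist _ _) _.
  rewrite [X in `|X|](_ : _ = - (L *m (v - v')^T)); last first.
    rewrite [(v - v')^T]linearB /= mulmxBr opprB opprB addrC.
    by rewrite [LHS]addrA subrK.
  rewrite normrN; apply: le_trans (mulmx_norm_le _ _) _.
  rewrite tr_norm; apply: (@le_trans _ _ ((opnorm L + 1) * `|v - v'|)).
    by rewrite ler_wpM2r // lerDl.
  by rewrite mulrC -ler_pdivlMr // ltr_wpDl // opnorm_ge0.
have K0 : K !=set0 by exists 0; apply/KP; rewrite normr0.
have [x xK xmin] := compact_EVT_min K0 cK (continuous_subspaceT cF).
exists x^T; first by rewrite tr_norm; apply/KP; rewrite inE in xK.
apply/ler_addgt0Pr => e e0; have [y y1 yc] := H e e0.
apply: le_trans yc; rewrite -[y]trmxK; apply: xmin.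
by rewrite inE; apply/KP; rewrite -tr_norm trmxK.
Unshelve. all: by end_near.
Qed.

End VectorNorms.

(** * Recovering increments from derivatives *)

Section Derivatives.
Context {R : realType} {V : normedModType R}.

Definition deriv_within (D : set R) (f : R -> V) (t : R) (v : V) : Prop :=
  forall e, 0 < e -> exists2 d, 0 < d & forall s, D s -> `|s - t| < d ->
    `|f s - f t - (s - t) *: v| <= e * `|s - t|.

Lemma deriv_within_sub (D D' : set R) f t v : D' `<=` D ->
  deriv_within D f t v -> deriv_within D' f t v.
Proof.
by move=> DD' H e /H[d d0 K]; exists d => // s /DD'; exact: K.
Qed.

(** Over setT the predicate is two-sided differentiability; over a segment it is
    one-sided at the end points. *)
Lemma is_deriveP f t v : is_derive t (1 : R) f v <-> deriv_within setT f t v.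
Proof.
split=> [[df <-] e e0|H].
  have /cvgrPdist_le/(_ _ e0) : (fun h : R => h^-1 *: ((f \o shift t) (h *: 1) - f t))
    @ 0^' --> 'D_1 f t by exact: df.
  rewrite /dnbhs /= near_withinE => -[d /= d0 K].
  exists d => // s _ std.
  have [->|st0] := eqVneq s t; first by rewrite !subrr scale0r subr0 !normr0 mulr0.
  have /= := K (s - t); rewrite sub0r normrN subr_eq0 => /(_ std st0).
  rewrite /= [_ *: 1]mulr1 subrK => H.
  have st : s - t != 0 by rewrite subr_eq0.
  rewrite [X in `|X|](_ : _ = (t - s) *: ('D_1 f t - (s - t)^-1 *: (f s - f t))).
    by rewrite normrZ mulrC [`|t - s|]distrC ler_wpM2r.
  rewrite scalerBr scalerA -(opprB s t) !scaleNr mulNr divff // scaleN1r opprK.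
  by rewrite addrC.
have cv : (fun h : R => h^-1 *: ((f \o shift t) (h *: 1) - f t)) @ 0^' --> v.
  apply/cvgrPdist_le => e e0; rewrite /dnbhs /= near_withinE.
  have [d d0 K] := H e e0; exists d => // h /=; rewrite sub0r normrN => hd h0.
  rewrite [h *: 1]mulr1; have := K (h + t) I; rewrite addrK => /(_ hd) H1.
  rewrite distrC.
  rewrite [X in `|X|](_ : _ = h^-1 *: (f (h + t) - f t - h *: v)); last first.
    by rewrite [RHS]scalerBr scalerA mulVf // scale1r.
  by rewrite normrZ normfV ler_pdivrMl ?normr_gt0 // mulrC.
by split; [apply/cvg_ex; exists v | exact/cvg_lim].
Qed.

Lemma has_deriv_onP a b f f' : has_deriv_on a b f f' <->
  forall t, t \in `[a, b] -> deriv_within `[a, b]%classic f t (f' t).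
Proof.
have aux t v s e : s != t ->
    (`|v - (s - t)^-1 *: (f s - f t)| <= e) = (`|f s - f t - (s - t) *: v| <= e * `|s - t|).
  move=> st; rewrite -ler_pdivrMr ?normr_gt0 ?subr_eq0 // mulrC -normfV -normrZ.
  by rewrite [in RHS]scalerBr scalerA mulVf ?subr_eq0 // scale1r distrC.
split=> H t tab.
  move=> e e0; have /cvgrPdist_le/(_ _ e0) := H t tab.
  rewrite near_withinE /dnbhs /= near_withinE => -[d /= d0 K].
  exists d => // s sab std.
  have [->|st0] := eqVneq s t; first by rewrite !subrr scale0r subr0 !normr0 mulr0.
  by rewrite -aux //; apply: K => //=; rewrite distrC.
apply/cvgrPdist_le => e e0; have [d d0 K] := H t tab e e0.
rewrite near_withinE /dnbhs /= near_withinE.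
by exists d => // s /=; rewrite distrC => std st sab; rewrite aux //; exact: K.
Qed.

Lemma deriv_straddle a b f t v : deriv_within `[a, b]%classic f t v ->
  forall e, 0 < e -> exists2 d, 0 < d & forall s r, a <= s -> s <= t -> t <= r ->
    r <= b -> t - s < d -> r - t < d ->
    `|f r - f s - (r - s) *: v| <= e * (r - s).
Proof.
move=> H e /H[d d0 K]; exists d => // s r as_ st tr rb tsd rtd.
have := K r; rewrite /= in_itv /= rb (le_trans as_ (le_trans st tr)).
rewrite [`|r - t|]ger0_norm ?subr_ge0 // => /(_ isT rtd) H1.
have := K s; rewrite /= in_itv /= as_ (le_trans st (le_trans tr rb)).
rewrite distrC [`|t - s|]ger0_norm ?subr_ge0 // => /(_ isT tsd) H2.
rewrite [X in `|X|](_ : _ = (f r - f t - (r - t) *: v) - (f s - f t - (s - t) *: v)).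
  apply: le_trans (ler_normB _ _) _; apply: le_trans (lerD H1 H2) _.
  by rewrite -mulrDr [r - t]addrC addrC addrA subrK addrC.
rewrite [in RHS]opprD addrACA -opprD -scalerBl [- (f s - f t)]opprB addrA subrK.
by congr (_ - _ *: _); rewrite opprB addrA subrK.
Qed.

End Derivatives.

Section DifferentialInclusion.
Context {R : realType}.

Lemma open_segment_nbhd (O : set R) t : open O -> O t ->
  exists2 d, 0 < d & forall x, `|x - t| < d -> O x.
Proof.
rewrite openE => /(_ t) H /H /nbhs_ballP[d /= d0 dO]; exists d => // x xt.
by apply: dO; rewrite -ball_normE /= distrC.
Qed.

(** The coordinate eta stands for the integral of xi: with |eta| <= t - s in place
    of a convex combination of values xi, the property to be propagated is additive
    in the interval. Intervals tagged at a point of E contribute nothing to eta;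
    their cost is recorded in a chain inside the small neighbourhood of E. *)
Lemma diff_inclusion n q (E : set R) (a b : R) (f : R -> 'cV[R]_n)
    (v0 : 'cV[R]_n) (L : 'M[R]_(n, q)) (P p : R -> R) : a <= b ->
  small_variation E a b f ->
  (forall t, a <= t -> t <= b -> ~ E t -> exists xi v,
     [/\ `|xi| <= 1, deriv_within `[a, b]%classic f t v
       & `|v - v0 - L *m xi| <= p t]) ->
  (forall t, a <= t -> t <= b ->
     deriv_within `[a, b]%classic P t (p t) /\ 0 <= p t) ->
  exists2 eta, `|eta| <= b - a
    & `|f b - f a - (b - a) *: v0 - L *m eta| <= P b - P a.
Proof.
move=> ab svf Hf HP.
suff H e : 0 < e -> exists2 eta, `|eta| <= b - a
    & `|(f b - f a - (b - a) *: v0) - L *m eta| <= P b - P a + e.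
  by apply: ball_image_closed; [rewrite subr_ge0 | exact: H].
(* The error e1 per unit of length accounts for the good intervals and the
   total error e1 for the chain, whence the divisor b - a + 1; the factor c
   also pays for the term (t - s) v0 on bad intervals. *)
move=> e0; pose e1 := e / (b - a + 1); pose c := 1 + `|v0|.
have ba0 : 0 < b - a + 1 by rewrite ltr_wpDl // subr_ge0.
have e10 : 0 < e1 by rewrite divr_gt0.
have c0 : 0 < c by rewrite ltr_pwDl.
have [W [oO EO HO]] := svf _ (divr_gt0 e10 c0).
pose Q s t := exists2 C, chain W s t C & exists2 eta : 'cV[R]_q, `|eta| <= t - s
    & `|f t - f s - (t - s) *: v0 - L *m eta| <= P t - P s + e1 * (t - s)
       + c * \sum_(J <- C) (`|f J.2 - f J.1| + (J.2 - J.1)).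
suff [C /HO HC [eta eta1 H]] : Q a b.
  exists eta => //; apply: le_trans H _.
  rewrite -addrA lerD2l; apply: (@le_trans _ _ (e1 * (b - a) + e1)).
    by rewrite lerD2l mulrC -ler_pdivlMr.
  by rewrite -{2}[e1]mulr1 -mulrDr /e1 divfK // gt_eqF.
apply: cousin => //.
- move=> s t r _ _ _ _ [C1 HC1 [x1 Hx1 H1]] [C2 HC2 [x2 Hx2 H2]].
  exists (C1 ++ C2); first exact: chain_cat HC2.
  exists (x1 + x2).
    by apply: le_trans (ler_normD _ _) _; apply: le_trans (lerD Hx1 Hx2) _; lra.
  rewrite [X in `|X|](_ : _ = (f t - f s - (t - s) *: v0 - L *m x1)
      + (f r - f t - (r - t) *: v0 - L *m x2)); last first.
    by rewrite mulmxDr; apply/matrixP => i j; rewrite !mxE; ring.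
  apply: le_trans (ler_normD _ _) _; apply: le_trans (lerD H1 H2) _.
  by rewrite big_cat /=; lra.
- move=> t at_ tb; have [HPt p0] := HP t at_ tb.
  have e20 : 0 < e1 / 2 by rewrite divr_gt0.
  have [d1 d10 K1] := deriv_straddle HPt e20.
  have [Et|nEt] := pselect (E t).
    have [d2 d20 K2] := open_segment_nbhd oO (EO _ Et).
    exists (Num.min d1 d2); first by rewrite lt_min d10.
    move=> s r as_ st tr rb; rewrite !lt_min => /andP[ts1 ts2] /andP[rt1 rt2].
    have sr : s <= r := le_trans st tr.
    exists [:: (s, r)].
      split=> //= x /andP[sx xr]; apply: K2; rewrite ltr_norml; lra.
    exists 0; first by rewrite normr0 subr_ge0.
    rewrite mulmx0 subr0 big_seq1 /=.
    apply: le_trans (ler_normB _ _) _; rewrite normrZ ger0_norm ?subr_ge0 //.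
    have := K1 s r as_ st tr rb ts1 rt1.
    rewrite ler_norml => /andP[H3 _].
    have H4 : 0 <= (r - s) * p t by rewrite mulr_ge0 // subr_ge0.
    have H5 : 0 <= `|v0| * `|f r - f s| by rewrite mulr_ge0.
    have H6 : 0 <= e1 * (r - s) by rewrite mulr_ge0 ?subr_ge0 // ltW.
    move: H3 H4 H5 H6; rewrite /c /GRing.scale /=.
    move: (`|f r - f s|) (`|v0|) => F Y; move: (P r) (P s) => Pr Ps.
    by move=> *; nra.
  have [xi [v [xi1 Hv vp]]] := Hf t at_ tb nEt.
  have [d2 d20 K2] := deriv_straddle Hv e20.
  exists (Num.min d1 d2); first by rewrite lt_min d10.
  move=> s r as_ st tr rb; rewrite !lt_min => /andP[ts1 ts2] /andP[rt1 rt2].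
  have sr : s <= r := le_trans st tr.
  exists [::] => //; exists ((r - s) *: xi).
    by rewrite normrZ ger0_norm ?subr_ge0 // ler_piMr // subr_ge0.
  rewrite big_nil mulr0 addr0.
  rewrite [X in `|X|](_ : _ = (f r - f s - (r - s) *: v)
      + (r - s) *: (v - v0 - L *m xi)); last first.
    by rewrite -scalemxAr; apply/matrixP => i j; rewrite !mxE; ring.
  apply: le_trans (ler_normD _ _) _.
  rewrite normrZ [`|r - s|]ger0_norm ?subr_ge0 //.
  have H2 := K2 s r as_ st tr rb ts2 rt2.
  have := K1 s r as_ st tr rb ts1 rt1.
  rewrite ler_norml => /andP[H3 _].
  have H4 : (r - s) * `|v - v0 - L *m xi| <= (r - s) * p t.
    by rewrite ler_wpM2l // subr_ge0.
  apply: le_trans (lerD H2 H4) _; move: H3; rewrite /GRing.scale /=.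
  by move=> *; lra.
Qed.

(** The case without a set-valued part. *)
Lemma diff_estimate n (E : set R) (a b : R) (f : R -> 'cV[R]_n)
    (v0 : 'cV[R]_n) (P p : R -> R) : a <= b ->
  small_variation E a b f ->
  (forall t, a <= t -> t <= b -> ~ E t -> exists2 v,
     deriv_within `[a, b]%classic f t v & `|v - v0| <= p t) ->
  (forall t, a <= t -> t <= b -> is_derive t 1 P (p t) /\ 0 <= p t) ->
  `|f b - f a - (b - a) *: v0| <= P b - P a.
Proof.
move=> ab svf Hf HP.
have [||eta _] := @diff_inclusion n 0 E a b f v0 0 P p ab svf.
- move=> t at_ tb nEt; have [v Hv vp] := Hf t at_ tb nEt.
  exists 0, v; split=> //; first by rewrite normr0.
  by rewrite mul0mx subr0.
- move=> t at_ tb; have [/is_deriveP HPt p0] := HP t at_ tb.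
  by split=> //; apply: deriv_within_sub HPt.
by rewrite mul0mx subr0.
Qed.

End DifferentialInclusion.

(** * Absolute continuity and Gronwall's inequality *)

Section AbsoluteContinuity.
Context {R : realType}.

Lemma ac_sub (V : normedModType R) (a b a' b' : R) (f : R -> V) : a <= a' -> b' <= b ->
  absolutely_continuous_on a b f -> absolutely_continuous_on a' b' f.
Proof.
move=> aa' bb' H e /H[d d0 K]; exists d => // k l r Hlr; apply: K => i.
by have [H1 H2 H3] := Hlr i; split=> //; [exact: le_trans H1|exact: le_trans bb'].
Qed.

Lemma acB (V : normedModType R) (a b : R) (f g : R -> V) :
  absolutely_continuous_on a b f -> absolutely_continuous_on a b g ->
  absolutely_continuous_on a b (fun t => f t - g t).
Proof.
move=> Hf Hg e e0; have e20 : 0 < e / 2 by rewrite divr_gt0.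
have [d1 d10 K1] := Hf _ e20; have [d2 d20 K2] := Hg _ e20.
exists (Num.min d1 d2); first by rewrite lt_min d10.
move=> k l r Hlr tI; rewrite lt_min => /andP[s1 s2].
have := ltrD (K1 k l r Hlr tI s1) (K2 k l r Hlr tI s2).
rewrite -splitr; apply: le_lt_trans; rewrite -big_split /=.
apply: ler_sum => i _; rewrite [- (f (l i) - _)]opprD addrACA -opprD.
exact: ler_normB.
Qed.

Lemma ac_uniform (V : normedModType R) (a b : R) (f : R -> V) : absolutely_continuous_on a b f ->
  forall e, 0 < e -> exists2 d, 0 < d & forall s t,
    a <= s <= b -> a <= t <= b -> `|s - t| < d -> `|f s - f t| < e.
Proof.
move=> H e /H[d d0 K]; exists d => // s t.
wlog ts : s t / t <= s.
  move=> W sab tab; have [|/ltW] := leP t s; first by move=> ?; apply: W.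
  by move=> ? ?; rewrite distrC; apply: W; rewrite // distrC.
move=> /andP[as_ sb] /andP[at_ tb]; rewrite ger0_norm ?subr_ge0 // => std.
have := K 1%N (fun=> t) (fun=> s); rewrite !big_ord1; apply=> //.
by apply/trivIsetP => i j _ _; rewrite (ord1 i) (ord1 j) eqxx.
Qed.

Lemma uniform_within_continuous (V : normedModType R) (a b : R) (f : R -> V) :
  (forall e, 0 < e -> exists2 d, 0 < d & forall s t,
    a <= s <= b -> a <= t <= b -> `|s - t| < d -> `|f s - f t| < e) ->
  {within `[a, b], continuous f}.
Proof.
move=> H; apply/subspace_continuousP => t /=; rewrite in_itv /= => tab.
apply/cvgrPdist_lt => e e0; have [d d0 K] := H e e0.
rewrite near_withinE; exists d => // s /=; rewrite in_itv /= => ts sab.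
exact: K.
Qed.

Lemma lipschitz_ac (V : normedModType R) (a b K : R) (f : R -> V) :
  (forall s t, a <= s -> s <= t -> t <= b -> `|f t - f s| <= K * (t - s)) ->
  absolutely_continuous_on a b f.
Proof.
move=> H e e0; have K1 : 0 < `|K| + 1 by rewrite ltr_wpDl.
exists (e / (`|K| + 1)); first by rewrite divr_gt0.
move=> k l r Hlr _; rewrite ltr_pdivlMr // mulrC => Hs.
apply: le_lt_trans Hs; rewrite mulr_sumr; apply: ler_sum => i _.
have [al lr rb] := Hlr i; apply: le_trans (H _ _ al lr rb) _.
apply: ler_wpM2r; first by rewrite subr_ge0.
by apply: le_trans (ler_norm _) _; rewrite lerDl.
Qed.

Lemma is_derive_comb (A A' B C t f' h' : R) (f h : R -> R) :
  is_derive t 1 f f' -> is_derive t 1 h h' ->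
  is_derive t 1 (fun s => A * f s + A' * h s + B * s + C) (A * f' + A' * h' + B).
Proof.
move=> Hf Hh.
have : is_derive t 1 (A \*: f + A' \*: h + B \*: id + cst C)
    (A *: f' + A' *: h' + B *: 1 + 0) by exact: _.
by rewrite addr0 /GRing.scale /= mulr1.
Qed.

Lemma is_derive_expR_lin (M c t : R) :
  is_derive t 1 (fun s => expR (M * (s - c))) (M * expR (M * (t - c))).
Proof.
have H : is_derive t 1 (fun s : R => M * (s - c)) M.
  have : is_derive t 1 (M \*: (id - cst c : R -> R)) (M *: (1 - 0)) by exact: _.
  by rewrite subr0 /GRing.scale /= mulr1.
have := @is_derive1_comp _ expR _ t _ _ (is_derive_expR (M * (t - c))) H.
by rewrite mulrC.
Qed.

(** The maximum of |w| / g, where g solves the comparison equation from a value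
    slightly above |w a|, cannot exceed 1: at a maximum rho > 1 the increment
    of w from a would be at most rho (g - g a), which forces |w| < rho g there. *)
Lemma gronwall n (E : set R) (a b M k : R) (w : R -> 'cV[R]_n) :
  0 < M -> 0 <= k -> a <= b -> absolutely_continuous_on a b w ->
  (@lebesgue_measure R).-negligible E ->
  (forall t, a <= t -> t <= b -> ~ E t -> exists2 v,
    deriv_within `[a, b]%classic w t v & `|v| <= M * `|w t| + k) ->
  forall t, a <= t -> t <= b ->
    `|w t| <= `|w a| * expR (M * (t - a)) + k / M * (expR (M * (t - a)) - 1).
Proof.
move=> M0 k0 ab acw nE Hw t at_ tb.
apply/ler_addgt0Pr => e e0.
pose eta := e / expR (M * (t - a)).
have eta0 : 0 < eta by rewrite divr_gt0 // expR_gt0.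
pose c := `|w a| + eta + k / M.
have kM : 0 <= k / M by rewrite divr_ge0 // ltW.
have c0 : 0 < c by rewrite ltr_wpDr // ltr_wpDl.
pose g s := c * expR (M * (s - a)) - k / M.
have gE s : M * g s + k = M * c * expR (M * (s - a)).
  by rewrite /g mulrBr [M * (k / M)]mulrC divfK ?gt_eqF //; ring.
have ga : g a = `|w a| + eta by rewrite /g subrr mulr0 expR0 mulr1 /c addrK.
have g_gt0 s : a <= s -> 0 < g s.
  move=> as_; have : 0 < g a by rewrite ga ltr_wpDl.
  move=> /lt_le_trans; apply; rewrite /g lerD2r ler_pM2l // ler_expR ler_pM2l //.
  by rewrite lerD2r.
have dg (s : R) : is_derive s (1 : R) (g : R -> R) (M * g s + k).
  have := is_derive_comb c 0 0 (- (k / M)) (is_derive_expR_lin M a s) (is_derive_expR_lin M a s).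
  rewrite (_ : (fun _ => _) = g); last by apply/funext => x; rewrite /g !mul0r !addr0.
  by move=> H; apply: is_derive_eq; rewrite gE; ring.
suff H : `|w t| <= g t.
  apply: le_trans H _; rewrite /g /c.
  have -> : e = eta * expR (M * (t - a)) by rewrite /eta divfK // gt_eqF // expR_gt0.
  by lra.
pose F s := `|w s| / g s.
have cF : {within `[a, b], continuous F}.
  apply/subspace_continuousP => s sab; have as_ : a <= s.
    by move: sab; rewrite /= in_itv /= => /andP[].
  apply: cvgM.
    apply: cvg_norm; move/subspace_continuousP: (uniform_within_continuous (ac_uniform acw)).
    by apply.
  apply: cvgV; first by rewrite gt_eqF // g_gt0.
  apply: cvg_within_filter; apply: differentiable_continuous.
  by apply/derivable1_diffP; case: (dg s).
have [x xab Fmax] := EVT_max ab cF; move: xab; rewrite in_itv /= => /andP[ax xb].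
have Ft : F t <= F x by apply: Fmax; rewrite in_itv /= at_ tb.
suff Fx1 : F x <= 1.
  by rewrite -[leRHS]mul1r -ler_pdivrMr ?g_gt0 //; exact: le_trans Fx1.
rewrite leNgt; apply/negP => Fx1.
have F0 : 0 <= F x by apply: ltW; apply: lt_trans Fx1.
have H : `|w x - w a - (x - a) *: 0| <= F x * g x - F x * g a.
  apply: (@diff_estimate _ _ E a x w 0 (fun s => F x * g s)
      (fun s => F x * (M * g s + k)) ax).
  - by apply: small_variation_ac => //; apply: ac_sub acw.
  - move=> s as_ sx nEs; have [v Hv vk] := Hw s as_ (le_trans sx xb) nEs.
    exists v; first by apply: deriv_within_sub Hv => y /=; rewrite !in_itv /= => /andP[-> /le_trans ->].
    rewrite subr0; apply: le_trans vk _.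
    have := Fmax s; rewrite in_itv /= as_ (le_trans sx xb) => /(_ isT).
    rewrite {1}/F ler_pdivrMr ?g_gt0 // => Hs.
    have : k <= F x * k by rewrite ler_peMl // ltW.
    have : M * `|w s| <= M * (F x * g s) by rewrite ler_pM2l.
    by lra.
  - move=> s as_ sx; split.
      have := is_derive_comb (F x) 0 0 0 (dg s) (dg s).
      rewrite (_ : (fun _ => _) = (fun s => F x * g s)).
        by move=> H; apply: is_derive_eq; rewrite mul0r !addr0.
      by apply/funext => y; rewrite !mul0r !addr0.
    by rewrite mulr_ge0 // addr_ge0 // mulr_ge0 // ltW // g_gt0.
have : `|w x| <= `|w x - w a - (x - a) *: 0| + `|w a|.
  rewrite scaler0 subr0; apply: le_trans (ler_normD _ _).
  by rewrite subrK.
have : `|w x| = F x * g x by rewrite /F divfK // gt_eqF // g_gt0.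
have : `|w a| < F x * g a.
  apply: (@lt_le_trans _ _ (g a)); first by rewrite ga ltrDl.
  by rewrite ler_peMl // ltW // g_gt0.
by lra.
Qed.

End AbsoluteContinuity.

(** * Estimates for solutions of the linear system *)

Section C1Matrices.
Context {R : realType}.

Lemma opnorm_le_norm k l (M : 'M[R]_(k, l)) : opnorm M <= l%:R * `|M|.
Proof.
rewrite /opnorm; apply/bigmax_leP; split; first by rewrite mulr_ge0.
move=> i _; have -> : l%:R = \sum_(j < l) 1 :> R by rewrite sumr_const card_ord.
rewrite mulr_suml.
apply: ler_sum => j _; rewrite mul1r [leRHS]mx_normrE.
by apply/bigmax_geP; right; exists (i, j).
Qed.

Lemma deriv_within_mulmx k l (D : set R) (M : R -> 'M[R]_(k, l)) t dM (v : 'cV[R]_l) :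
  deriv_within D M t dM -> deriv_within D (fun s => M s *m v) t (dM *m v).
Proof.
move=> H e e0; have c0 : 0 < l%:R * `|v| + 1 by rewrite ltr_wpDl // mulr_ge0.
have [d d0 K] := H _ (divr_gt0 e0 c0).
exists d => // s Ds std; rewrite -mulmxBl scalemxAl -mulmxBl.
apply: le_trans (mulmx_norm_le _ _) _.
apply: (@le_trans _ _ (l%:R * `|M s - M t - (s - t) *: dM| * `|v|)).
  by rewrite ler_wpM2r // opnorm_le_norm.
rewrite mulrAC.
apply: (@le_trans _ _ ((l%:R * `|v| + 1) * `|M s - M t - (s - t) *: dM|)).
  by rewrite ler_wpM2r // lerDl.
rewrite mulrC -ler_pdivlMr // mulrAC; exact: K.
Qed.

Lemma C1_lipschitz k l (a b K : R) (M dM : R -> 'M[R]_(k, l)) :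
  has_deriv_on a b M dM -> (forall t, t \in `[a, b] -> opnorm (dM t) <= K) ->
  forall s t (v : 'cV[R]_l), a <= s -> s <= t -> t <= b ->
    `|(M t - M s) *m v| <= K * (t - s) * `|v|.
Proof.
move=> /has_deriv_onP HM HK s t v as_ st tb.
have K0 : 0 <= K.
  apply: le_trans (opnorm_ge0 _) (HK s _).
  by rewrite in_itv /= as_ (le_trans st).
have := @diff_estimate R k set0 s t (fun t => M t *m v) 0
  (fun t => (K * `|v|) * t) (fun=> K * `|v|) st.
rewrite scaler0 subr0 mulmxBl => H; apply: le_trans (H _ _ _) _.
- exact: small_variation_set0.
- move=> x sx xt _; exists (dM x *m v).
    apply: deriv_within_sub (deriv_within_mulmx v (HM x _)).
      by move=> y /=; rewrite !in_itv /= => /andP[/(le_trans as_) -> /le_trans ->].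
    by rewrite in_itv /= (le_trans as_ sx) (le_trans xt tb).
  rewrite subr0; apply: le_trans (mulmx_norm_le _ _) _; rewrite ler_wpM2r // HK //.
  by rewrite in_itv /= (le_trans as_ sx) (le_trans xt tb).
- move=> x _ _; split; last by rewrite mulr_ge0.
  have : is_derive x 1 ((K * `|v|) \*: (id : R -> R)) ((K * `|v|) *: 1) by exact: _.
  by rewrite /GRing.scale /= mulr1.
- by rewrite le_eqVlt -mulrBr; apply/orP; left; apply/eqP; ring.
Qed.

End C1Matrices.

Section LinearSystem.
Context {R : realType} {n m : nat}.
Variables (t0 tf : R) (A dA : R -> 'M[R]_n) (B dB : R -> 'M[R]_(n, m)).
Variables (MA MdA MB MdB : R) (phi : R -> R -> 'M[R]_n).
Hypothesis t0_lt_tf : t0 < tf.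
Hypothesis A_C1 : C1_on t0 tf A dA.
Hypothesis B_C1 : C1_on t0 tf B dB.
Hypothesis MA_gt0 : 0 < MA.
Hypothesis A_le : forall t : R, t \in `[t0, tf] -> opnorm (A t) <= MA.
Hypothesis dA_le : forall t : R, t \in `[t0, tf] -> opnorm (dA t) <= MdA.
Hypothesis B_le : forall t : R, t \in `[t0, tf] -> opnorm (B t) <= MB.
Hypothesis dB_le : forall t : R, t \in `[t0, tf] -> opnorm (dB t) <= MdB.
Hypothesis phiP : is_transition_matrix A B t0 tf phi.

Let t0_in : t0 \in `[t0, tf]. Proof. by rewrite in_itv /= lexx ltW. Qed.

Let in_t0tf t : t0 <= t -> t <= tf -> t \in `[t0, tf].
Proof. by move=> ? ?; rewrite in_itv /=; apply/andP. Qed.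

Lemma bounds_ge0 : [/\ 0 <= MdA, 0 <= MB & 0 <= MdB].
Proof.
split; [move: (dA_le t0_in)|move: (B_le t0_in)|move: (dB_le t0_in)];
  exact: le_trans (opnorm_ge0 _).
Qed.

Lemma A_mul_le t (v : 'cV[R]_n) : t0 <= t -> t <= tf -> `|A t *m v| <= MA * `|v|.
Proof.
move=> at_ tb; apply: le_trans (mulmx_norm_le _ _) _; rewrite ler_wpM2r // A_le //.
by rewrite in_itv /= at_ tb.
Qed.

Lemma B_mul_le t (v : 'cV[R]_m) : t0 <= t -> t <= tf -> `|B t *m v| <= MB * `|v|.
Proof.
move=> at_ tb; apply: le_trans (mulmx_norm_le _ _) _; rewrite ler_wpM2r // B_le //.
by rewrite in_itv /= at_ tb.
Qed.

Lemma solution_deriv (a b s : R) p u x : is_solution A B a b s p u x ->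
  exists2 E, (@lebesgue_measure R).-negligible E & forall t, a <= t -> t <= b ->
    ~ E t -> deriv_within setT x t (A t *m x t + B t *m u t).
Proof.
case=> _ _ ae; exists (~` [set t | t \in `[a, b] -> is_derive t 1 x (A t *m x t + B t *m u t)]).
  exact: ae.
move=> t at_ tb /contrapT H; apply/is_deriveP; apply: H.
by rewrite in_itv /= at_ tb.
Qed.

Lemma phi_ac s (p : 'cV[R]_n) : t0 <= s -> s <= tf ->
  absolutely_continuous_on t0 tf (fun t => phi t s *m p).
Proof. by move=> ts st; case: (phiP (in_t0tf ts st) p). Qed.

Lemma phi_id s (p : 'cV[R]_n) : t0 <= s -> s <= tf -> phi s s *m p = p.
Proof. by move=> ts st; case: (phiP (in_t0tf ts st) p). Qed.

Lemma phi_deriv s (p : 'cV[R]_n) : t0 <= s -> s <= tf ->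
  exists2 E, (@lebesgue_measure R).-negligible E & forall t, t0 <= t -> t <= tf ->
    ~ E t -> deriv_within setT (fun t => phi t s *m p) t (A t *m (phi t s *m p)).
Proof.
move=> ts st; have /solution_deriv[E nE H] := phiP (in_t0tf ts st) p.
by exists E => // t at_ tb /H; rewrite mulmx0 addr0; exact.
Qed.

Lemma phi_bound s t (p : 'cV[R]_n) : t0 <= s -> s <= t -> t <= tf ->
  `|phi t s *m p| <= `|p| * expR (MA * (t - s)).
Proof.
move=> ts st tt; have stf := le_trans st tt.
have [E nE HE] := phi_deriv p ts stf.
have := @gronwall R n E s tf MA 0 (fun t => phi t s *m p) MA_gt0 (lexx _) stf.
rewrite phi_id // mul0r => H.
apply: le_trans (H _ nE _ t st tt) _; last by rewrite mul0r addr0.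
- by apply: ac_sub (phi_ac p ts stf).
- move=> x sx xt nEx; exists (A x *m (phi x s *m p)).
    by apply: deriv_within_sub (HE _ _ _ nEx) => //; exact: le_trans sx.
  by rewrite addr0; apply: A_mul_le => //; exact: le_trans sx.
Qed.

Lemma phi_incr s t t' (p : 'cV[R]_n) : t0 <= s -> s <= t -> t <= t' -> t' <= tf ->
  `|phi t' s *m p - phi t s *m p| <=
    `|p| * (expR (MA * (t' - s)) - expR (MA * (t - s))).
Proof.
move=> ts st tt' tf'; have ttf := le_trans tt' tf'; have stf := le_trans st ttf.
have [E nE HE] := phi_deriv p ts stf.
have := @diff_estimate R n E t t' (fun t => phi t s *m p) 0
  (fun x => `|p| * expR (MA * (x - s)) + 0 * expR (MA * (x - s)) + 0 * x + 0)
  (fun x => `|p| * (MA * expR (MA * (x - s))) + 0 * (MA * expR (MA * (x - s))) + 0) tt'.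
rewrite scaler0 subr0 => H; apply: le_trans (H _ _ _) _.
- apply: small_variation_ac => //; apply: ac_sub (phi_ac p ts stf) => //.
  exact: le_trans st.
- move=> x tx xt nEx; have sx := le_trans st tx; have xtf := le_trans xt tf'.
  exists (A x *m (phi x s *m p)).
    by apply: deriv_within_sub (HE _ _ _ nEx) => //; exact: le_trans sx.
  rewrite subr0 mul0r !addr0; apply: le_trans (A_mul_le _ (le_trans ts sx) xtf) _.
  by rewrite mulrCA ler_pM2l // phi_bound.
- move=> x _ _; split.
    by apply: is_derive_comb; exact: is_derive_expR_lin.
  by rewrite mul0r !addr0 mulr_ge0 // mulr_ge0 ?expR_ge0 // ltW.
- by rewrite le_eqVlt; apply/orP; left; apply/eqP; ring.
Qed.

Let C := MA + MdA / MA.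

Let C_ge0 : 0 <= C.
Proof. by have [? _ _] := bounds_ge0; rewrite addr_ge0 ?divr_ge0 // ltW. Qed.

(** The increment of A acts on the earlier of the two states, so that the growth
    bound at the earlier time suffices and everything is dominated by the increment
    of one exponential. *)
Lemma phi_velocity_incr s t t' (p : 'cV[R]_n) : t0 <= s -> s <= t -> t <= t' -> t' <= tf ->
  `|A t' *m (phi t' s *m p) - A t *m (phi t s *m p)| <=
    C * `|p| * (expR (MA * (t' - s)) - expR (MA * (t - s))).
Proof.
move=> ts st tt' tf'; have ttf := le_trans tt' tf'; have t0t := le_trans ts st.
rewrite [X in `|X|](_ : _ = (A t' - A t) *m (phi t s *m p)
    + A t' *m (phi t' s *m p - phi t s *m p)); last first.
  by rewrite mulmxBl mulmxBr [LHS]addrC [RHS]addrC [RHS]addrA subrK [LHS]addrC.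
apply: le_trans (ler_normD _ _) _.
have H1 := C1_lipschitz A_C1.1 dA_le (phi t s *m p) t0t tt' tf'.
have H2 := A_mul_le (phi t' s *m p - phi t s *m p) (le_trans t0t tt') tf'.
apply: le_trans (lerD H1 H2) _.
have H3 := phi_incr p ts st tt' tf'; have H4 := phi_bound p ts st ttf.
have [MdA0 _ _] := bounds_ge0.
have H5 : expR (MA * (t - s)) * (MA * (t' - t)) <=
    expR (MA * (t' - s)) - expR (MA * (t - s)).
  have -> : MA * (t' - s) = MA * (t - s) + MA * (t' - t) by ring.
  rewrite expRD -{3}[expR (MA * (t - s))]mulr1 -mulrBr ler_pM2l ?expR_gt0 //.
  by have := expR_ge1Dx (MA * (t' - t)); lra.
have -> : C * `|p| * (expR (MA * (t' - s)) - expR (MA * (t - s))) =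
    MdA / MA * (`|p| * (expR (MA * (t' - s)) - expR (MA * (t - s))))
    + MA * (`|p| * (expR (MA * (t' - s)) - expR (MA * (t - s)))).
  by rewrite /C; ring.
apply: lerD; last by rewrite ler_pM2l.
have -> : MdA * (t' - t) * `|phi t s *m p| = MdA / MA * (MA * (t' - t) * `|phi t s *m p|).
  by field; rewrite gt_eqF.
rewrite ler_wpM2l ?divr_ge0 ?(ltW MA_gt0) //.
apply: le_trans (ler_wpM2l _ H4) _.
  by rewrite mulr_ge0 ?(ltW MA_gt0) // subr_ge0.
by rewrite mulrCA ler_wpM2l // mulrC.
Qed.

(** First order expansion of a trajectory of the homogeneous system around any
    time t, forwards and backwards; the remainder is the integral of the bound
    for the variation of the velocity. *)
Lemma phi_taylor s t t' (p : 'cV[R]_n) : t0 <= s -> s <= t -> s <= t' -> t <= tf -> t' <= tf ->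
  `|phi t' s *m p - phi t s *m p - (t' - t) *: (A t *m (phi t s *m p))| <=
    C * `|p| * ((expR (MA * (t' - s)) - expR (MA * (t - s))) / MA
                - (t' - t) * expR (MA * (t - s))).
Proof.
move=> ts st st' ttf tf'; have stf := le_trans st ttf.
have [E nE HE] := phi_deriv p ts stf.
have Cp0 : 0 <= C * `|p| by rewrite mulr_ge0 ?C_ge0.
set et := expR (MA * (t - s)).
have mono x y : x <= y -> expR (MA * (x - s)) <= expR (MA * (y - s)).
  by move=> xy; rewrite ler_expR ler_pM2l // lerD2r.
have [tt'|/ltW t't] := leP t t'.
  pose a1 := C * `|p| / MA; pose b1 := - (C * `|p| * et).
  have := @diff_estimate R n E t t' (fun t => phi t s *m p) (A t *m (phi t s *m p))
    (fun x => a1 * expR (MA * (x - s)) + 0 * expR (MA * (x - s)) + b1 * x + 0)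
    (fun x => a1 * (MA * expR (MA * (x - s))) + 0 * (MA * expR (MA * (x - s))) + b1) tt'.
  have vE x : a1 * (MA * expR (MA * (x - s))) + 0 * (MA * expR (MA * (x - s))) + b1 =
      C * `|p| * (expR (MA * (x - s)) - et).
    by rewrite /a1 /b1; field; rewrite gt_eqF.
  move=> H; apply: le_trans (H _ _ _) _.
  - apply: small_variation_ac => //; apply: ac_sub (phi_ac p ts stf) => //.
    exact: le_trans st.
  - move=> x tx xt nEx; have sx := le_trans st tx; have xtf := le_trans xt tf'.
    exists (A x *m (phi x s *m p)).
      by apply: deriv_within_sub (HE _ _ _ nEx) => //; exact: le_trans sx.
    by rewrite vE; exact: phi_velocity_incr.
  - move=> x tx _; split.
      by apply: is_derive_comb; exact: is_derive_expR_lin.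
    by rewrite vE mulr_ge0 // subr_ge0 mono.
  - rewrite le_eqVlt; apply/orP; left; apply/eqP; rewrite /a1 /b1 /et.
    by field; rewrite gt_eqF.
rewrite -normrN.
rewrite [X in `|X|](_ : _ = phi t s *m p - phi t' s *m p
    - (t - t') *: (A t *m (phi t s *m p))); last first.
  by rewrite opprB opprB addrC -scaleNr opprB.
(* Backwards in time the same primitive occurs with the opposite sign. *)
pose a1 := - (C * `|p| / MA); pose b1 := C * `|p| * et.
have := @diff_estimate R n E t' t (fun t => phi t s *m p) (A t *m (phi t s *m p))
  (fun x => a1 * expR (MA * (x - s)) + 0 * expR (MA * (x - s)) + b1 * x + 0)
  (fun x => a1 * (MA * expR (MA * (x - s))) + 0 * (MA * expR (MA * (x - s))) + b1) t't.
have vE x : a1 * (MA * expR (MA * (x - s))) + 0 * (MA * expR (MA * (x - s))) + b1 =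
    C * `|p| * (et - expR (MA * (x - s))).
  by rewrite /a1 /b1; field; rewrite gt_eqF.
move=> H; apply: le_trans (H _ _ _) _.
- apply: small_variation_ac => //; apply: ac_sub (phi_ac p ts stf) => //.
  exact: le_trans st'.
- move=> x tx xt nEx; have sx := le_trans st' tx; have xtf := le_trans xt ttf.
  exists (A x *m (phi x s *m p)).
    by apply: deriv_within_sub (HE _ _ _ nEx) => //; exact: le_trans sx.
  by rewrite vE distrC; exact: phi_velocity_incr.
- move=> x tx xt; split.
    by apply: is_derive_comb; exact: is_derive_expR_lin.
  by rewrite vE mulr_ge0 // subr_ge0 mono.
- rewrite le_eqVlt; apply/orP; left; apply/eqP; rewrite /a1 /b1 /et.
  by field; rewrite gt_eqF.
Qed.

(** The error of linear interpolation between s and T; the expansions around t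
    at both end points are averaged so that the linear terms cancel. *)
Lemma phi_interpolation s t T l (p : 'cV[R]_n) :
  t0 <= s -> s <= t -> t <= T -> T <= tf -> s < T -> l = (t - s) / (T - s) ->
  `|phi t s *m p - ((1 - l) *: p + l *: (phi T s *m p))| <=
    aux_gamma MA MdA (T - s) * `|p|.
Proof.
move=> ts st tT Tf sT lE; have ttf := le_trans tT Tf; have stf := le_trans st ttf.
have h0 : 0 < T - s by rewrite subr_gt0.
have l0 : 0 <= l by rewrite lE divr_ge0 // ?subr_ge0 // ltW.
have l1 : l <= 1 by rewrite lE ler_pdivrMr // mul1r lerD2r.
have lh : l * (T - s) = t - s by rewrite lE divfK // gt_eqF.
have E1 := phi_taylor p ts st (lexx s) ttf stf.
have E2 := phi_taylor p ts st (ltW sT) ttf Tf.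
rewrite (phi_id p ts stf) in E1.
set v := A t *m _ in E1 E2.
rewrite -normrN.
rewrite [X in `|X|](_ : _ = (1 - l) *: (p - phi t s *m p - (s - t) *: v)
    + l *: (phi T s *m p - phi t s *m p - (T - t) *: v)); last first.
  have cf : (1 - l) * (s - t) + l * (T - t) = 0.
    rewrite (_ : _ + _ = l * (T - s) - (t - s)); last by ring.
    by rewrite lh subrr.
  rewrite [RHS](_ : _ = (1 - l) *: p + l *: (phi T s *m p) - phi t s *m p
    - ((1 - l) * (s - t) + l * (T - t)) *: v); last first.
    by apply/matrixP => i j; rewrite !mxE; ring.
  by rewrite cf scale0r subr0 opprB.
apply: le_trans (ler_normD _ _) _; rewrite !normrZ !ger0_norm ?subr_ge0 //.
have l1' : 0 <= 1 - l by rewrite subr_ge0.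
apply: le_trans (lerD (ler_wpM2l l1' E1) (ler_wpM2l l0 E2)) _.
rewrite subrr mulr0 expR0.
set et := expR (MA * (t - s)); set eT := expR (MA * (T - s)).
have -> : (1 - l) * (C * `|p| * ((1 - et) / MA - (s - t) * et))
    + l * (C * `|p| * ((eT - et) / MA - (T - t) * et)) =
    `|p| * (C / MA) * (1 - l + l * eT - et).
  have tE : t = l * (T - s) + s by rewrite lh subrK.
  rewrite {1 2}tE; field; by rewrite gt_eqF.
have -> : aux_gamma MA MdA (T - s) * `|p| =
    `|p| * (C / MA) * (eT - 1 - (T - s) * MA).
  rewrite /aux_gamma /aux_r /C /eT [(T - s) * MA]mulrC; field.
  by rewrite gt_eqF.
apply: ler_wpM2l; first by rewrite mulr_ge0 // divr_ge0 ?C_ge0 // ltW.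
have Het : 1 + MA * (l * (T - s)) <= et by rewrite lh; exact: expR_ge1Dx.
have HeT : 1 + MA * (T - s) <= eT by exact: expR_ge1Dx.
have : 0 <= (1 - l) * (eT - 1 - MA * (T - s)) by rewrite mulr_ge0 //; lra.
by lra.
Qed.

(** The part w of the trajectory that is due to the input starts at 0, so
    Gronwall bounds |w|; the velocity of w differs from B(T) u(t) by at most
    MA |w| + MdB (T - t) K, and [diff_inclusion] integrates this. *)
Lemma input_estimate q (c : 'cV[R]_m) (G : 'M[R]_(m, q)) (K s t1 T : R)
    (E : set R) (u : R -> 'cV[R]_m) (x : R -> 'cV[R]_n) :
  t0 <= s -> s <= t1 -> t1 <= T -> T <= tf ->
  (forall v, zonotope c G v -> `|v| <= K) ->
  absolutely_continuous_on s t1 x ->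
  (@lebesgue_measure R).-negligible E ->
  (forall t, s <= t -> t <= t1 -> zonotope c G (u t)) ->
  (forall t, s <= t -> t <= t1 -> ~ E t ->
     deriv_within setT x t (A t *m x t + B t *m u t)) ->
  exists2 xi, `|xi| <= 1 &
    `|x t1 - phi t1 s *m x s - (t1 - s) *: (B T *m (c + G *m xi))| <=
      aux_r MA (t1 - s) * K * ((MdB + MA * MB) / MA ^+ 2)
      + (T - t1) * (t1 - s) * MdB * K.
Proof.
move=> ts st tT Tf UK acx nE Uu Hx.
have t1f := le_trans tT Tf; have stf := le_trans st t1f; have sT := le_trans st tT.
have [F nF HF] := phi_deriv (x s) ts stf.
have [MdA0 MB0 MdB0] := bounds_ge0.
have K0 : 0 <= K by apply: le_trans (UK _ (Uu s (lexx s) st)).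
pose w t := x t - phi t s *m x s.
have ws : w s = 0 by rewrite /w phi_id // subrr.
have acw : absolutely_continuous_on s t1 w.
  by apply: acB => //; apply: ac_sub (phi_ac (x s) ts stf).
have nEF : (@lebesgue_measure R).-negligible (E `|` F) by exact: negligibleU.
have Hw t : s <= t -> t <= t1 -> ~ (E `|` F) t ->
    deriv_within `[s, t1]%classic w t (A t *m w t + B t *m u t).
  move=> st' tt1 /not_orP[nEt nFt].
  have H1 := Hx t st' tt1 nEt.
  have H2 := HF t (le_trans ts st') (le_trans tt1 t1f) nFt.
  apply: (@deriv_within_sub _ _ setT) => //.
  rewrite (_ : _ + _ = (A t *m x t + B t *m u t) - A t *m (phi t s *m x s)).
    apply/is_deriveP; apply: is_deriveB; exact/is_deriveP.
  by rewrite /w mulmxBr addrAC.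
have BKu t : s <= t -> t <= t1 -> `|B t *m u t| <= MB * K.
  move=> st' tt1; apply: le_trans (B_mul_le _ _ _) _.
  - exact: le_trans st'.
  - exact: le_trans t1f.
  - by rewrite ler_wpM2l //; apply: UK; exact: Uu.
have w_le t : s <= t -> t <= t1 -> `|w t| <= MB * K / MA * (expR (MA * (t - s)) - 1).
  move=> st' tt1.
  have := @gronwall R n (E `|` F) s t1 MA (MB * K) w MA_gt0 (mulr_ge0 MB0 K0) st acw nEF.
  move=> /(_ _ t st' tt1); rewrite ws normr0 mul0r add0r; apply => // y sy yt nEy.
  exists (A y *m w y + B y *m u y); first exact: Hw.
  apply: le_trans (ler_normD _ _) _; apply: lerD; last exact: BKu.
  by apply: A_mul_le; [exact: le_trans sy | exact: le_trans yt _].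
(* Coefficients of a primitive of the velocity error. In it t1 - t is replaced
   by the larger (exp (MA (t1 - t)) - 1) / MA, whose integral over [s, t1] is
   aux_r (t1 - s) / MA^2. *)
pose a1 := MB * K / MA; pose a2 := - (MdB * K / MA ^+ 2).
pose b1 := MdB * K * (T - t1) - MB * K - MdB * K / MA.
have [||eta eta1 H] := @diff_inclusion R n q (E `|` F) s t1 w (B T *m c) (B T *m G)
  (fun t => a1 * expR (MA * (t - s)) + a2 * expR (- MA * (t - t1)) + b1 * t + 0)
  (fun t => a1 * (MA * expR (MA * (t - s))) + a2 * (- MA * expR (- MA * (t - t1))) + b1)
  st (small_variation_ac acw nEF).
- move=> t st' tt1 nEt.
  have /zonotopeP[xi xi1 uE] := Uu t st' tt1.
  exists xi, (A t *m w t + B t *m u t); split => //; first exact: Hw.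
  rewrite [X in `|X|](_ : _ = A t *m w t - (B T - B t) *m u t); last first.
    by rewrite -mulmxA -addrA -opprD -mulmxDr -uE mulmxBl opprB addrA.
  apply: le_trans (ler_normB _ _) _.
  have H1 := A_mul_le (w t) (le_trans ts st') (le_trans tt1 t1f).
  have H2 := C1_lipschitz B_C1.1 dB_le (u t) (le_trans ts st') (le_trans tt1 tT) Tf.
  apply: le_trans (lerD H1 H2) _.
  have H3 : MA * `|w t| <= MB * K * (expR (MA * (t - s)) - 1).
    apply: (@le_trans _ _ (MA * (MB * K / MA * (expR (MA * (t - s)) - 1)))).
      by rewrite ler_pM2l // w_le.
    by rewrite le_eqVlt; apply/orP; left; apply/eqP; field; rewrite gt_eqF.
  have H4 : MdB * (T - t) * `|u t| <= MdB * (T - t) * K.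
    apply: ler_wpM2l; last by apply: UK; exact: Uu.
    by rewrite mulr_ge0 // subr_ge0 (le_trans tt1).
  have H5 : MdB * K / MA * (1 + - MA * (t - t1)) <= MdB * K / MA * expR (- MA * (t - t1)).
    by rewrite ler_wpM2l ?expR_ge1Dx // divr_ge0 ?mulr_ge0 // ltW.
  apply: le_trans (lerD H3 H4) _.
  rewrite /a1 /a2 /b1.
  have -> : MB * K / MA * (MA * expR (MA * (t - s))) = MB * K * expR (MA * (t - s)).
    by field; rewrite gt_eqF.
  have -> : - (MdB * K / MA ^+ 2) * (- MA * expR (- MA * (t - t1)))
     = MdB * K / MA * expR (- MA * (t - t1)) by field; rewrite gt_eqF.
  have e6 : MdB * K / MA * (1 + - MA * (t - t1)) = MdB * K / MA - MdB * K * (t - t1).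
    by field; rewrite gt_eqF.
  by lra.
- move=> t st' tt1; split.
    apply: (@deriv_within_sub _ _ setT) => //; apply/is_deriveP.
    by apply: is_derive_comb; exact: is_derive_expR_lin.
  rewrite /a1 /a2 /b1.
  have -> : MB * K / MA * (MA * expR (MA * (t - s))) = MB * K * expR (MA * (t - s)).
    by field; rewrite gt_eqF.
  have -> : - (MdB * K / MA ^+ 2) * (- MA * expR (- MA * (t - t1)))
     = MdB * K / MA * expR (- MA * (t - t1)) by field; rewrite gt_eqF.
  have : MB * K * 1 <= MB * K * expR (MA * (t - s)).
    apply: ler_wpM2l; first exact: mulr_ge0.
    by rewrite -expR0 ler_expR mulr_ge0 ?subr_ge0 // ltW.
  have : MdB * K / MA * 1 <= MdB * K / MA * expR (- MA * (t - t1)).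
    apply: ler_wpM2l; first by rewrite divr_ge0 ?mulr_ge0 // ltW.
    by rewrite -expR0 ler_expR mulNr -mulrN opprB mulr_ge0 ?subr_ge0 // ltW.
  have : 0 <= MdB * K * (T - t1) by rewrite !mulr_ge0 ?subr_ge0.
  by lra.
have [ts1|] := ltP s t1; last first.
  move=> t1s; have {t1s}ts1 : t1 = s by apply/eqP; rewrite eq_le t1s st.
  exists 0; first by rewrite normr0.
  by rewrite ts1 phi_id // !subrr scale0r subr0 normr0 /aux_r mul0r expR0 !subrr !mul0r mulr0 !mul0r addr0.
have h0 : 0 < t1 - s by rewrite subr_gt0.
exists ((t1 - s)^-1 *: eta).
  by rewrite normrZ normfV gtr0_norm // ler_pdivrMl // mulr1.
move: H; rewrite ws subr0.
rewrite [X in `|X|](_ : _ = x t1 - phi t1 s *m x s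
  - (t1 - s) *: (B T *m (c + G *m ((t1 - s)^-1 *: eta)))); last first.
  rewrite /w mulmxDr scalerDr -!scalemxAr scalerA divff ?gt_eqF // scale1r.
  by rewrite opprD mulmxA addrA.
move=> H; apply: le_trans H _.
rewrite le_eqVlt; apply/orP; left; apply/eqP.
have -> : - MA * (s - t1) = MA * (t1 - s) by ring.
rewrite !subrr !mulr0 expR0 /aux_r [(t1 - s) * MA]mulrC /a1 /a2 /b1.
by field; rewrite gt_eqF.
Qed.

End LinearSystem.

(** * The tube is contained in the union of the zonotopes *)

Section ZonotopeLemmas.
Context {R : realType}.

Lemma col_mx_norm_le1 k l (v : 'cV[R]_k) (w : 'cV[R]_l) :
  `|v| <= 1 -> `|w| <= 1 -> `|col_mx v w| <= 1.
Proof.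
move=> /cV_norm_leP v1 /cV_norm_leP w1; apply/cV_norm_leP => // i.
by rewrite mxE; case: (fintype.split i) => j; [exact: v1|exact: w1].
Qed.

Lemma col_mx_norm_le1_inv k l (v : 'cV[R]_k) (w : 'cV[R]_l) :
  `|col_mx v w| <= 1 -> `|v| <= 1 /\ `|w| <= 1.
Proof.
move=> /cV_norm_leP H; split; apply/cV_norm_leP => // i.
  by have := H ler01 (lshift l i); rewrite col_mxEu.
by have := H ler01 (rshift k i); rewrite col_mxEd.
Qed.

Lemma scalar_ball k (v : 'cV[R]_k) (s : R) : `|v| <= s ->
  exists2 z : 'cV[R]_k, `|z| <= 1 & v = s%:M *m z.
Proof.
move=> vs; have s0 : 0 <= s := le_trans (normr_ge0 _) vs.
have [s_eq0|s_neq0] := eqVneq s 0.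
  exists 0; first by rewrite normr0.
  by apply/eqP; rewrite mulmx0 -normr_le0 -s_eq0.
have s_gt0 : 0 < s by rewrite lt_neqAle eq_sym s_neq0.
exists (s^-1 *: v); last by rewrite mul_scalar_mx scalerA divff // scale1r.
by rewrite normrZ normfV gtr0_norm // ler_pdivrMl // mulr1.
Qed.

Lemma zonotope_norm_le k l (b : 'cV[R]_k) (F : 'M[R]_(k, l)) y :
  zonotope b F y -> `|y| <= opnorm (row_mx b F).
Proof.
case/zonotopeP => x x1 ->.
have -> : b + F *m x = row_mx b F *m col_mx 1 x by rewrite mul_row_col mulmx1.
apply: le_trans (mulmx_norm_le _ _) _; rewrite ler_piMr ?opnorm_ge0 //.
apply: col_mx_norm_le1 => //; apply/cV_norm_leP => // i.
by rewrite mxE (ord1 i) normr1.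
Qed.

Lemma zonotope_set_norm k l (b : 'cV[R]_k) (F : 'M[R]_(k, l)) y :
  zonotope b F y -> `|y| <= set_norm (zonotope b F).
Proof.
move=> zy; apply: sup_ubound; last by exists y.
by exists (opnorm (row_mx b F)) => _ [x zx <-]; exact: zonotope_norm_le zx.
Qed.

(** The generators (b - c) / 2 and (F - G) / 2 of the enclosure carry the position
    on the segment and its product with z. *)
Lemma enclosure_segment k l (b c : 'cV[R]_k) (F G : 'M[R]_(k, l)) (z : 'cV[R]_l) (t : R) :
  0 <= t -> t <= 1 -> `|z| <= 1 -> let dJ := enclosure (b, F) (c, G) in
  zonotope dJ.1 dJ.2 ((1 - t) *: (b + F *m z) + t *: (c + G *m z)).
Proof.
move=> s0 s1 z1 /=; apply/zonotopeP.
(* The middle coordinate 1 - 2 t interpolates between 1 at t = 0 and -1 at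
   t = 1; the last block carries the product of this number with z. *)
have m1 : `|1 - 2 * t| <= 1 by rewrite ler_norml; lra.
exists (col_mx z (col_mx (1 - 2 * t)%:M ((1 - 2 * t) *: z))).
  apply: col_mx_norm_le1 => //; apply: col_mx_norm_le1.
    by apply/cV_norm_leP => // i; rewrite mxE (ord1 i) eqxx mulr1n.
  by rewrite normrZ mulr_ile1.
rewrite !mul_row_col mul_mx_scalar -scalemxAr -!scalemxAl !mulmxDl mulNmx.
move: (F *m z) (G *m z) => x y; apply/matrixP => i j; rewrite !mxE.
by field.
Qed.

Lemma zonotope_row k l l' (b : 'cV[R]_k) (F : 'M[R]_(k, l)) (G : 'M[R]_(k, l')) y w :
  zonotope b F y -> (exists2 z : 'cV[R]_l', `|z| <= 1 & w = G *m z) ->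
  zonotope b (row_mx F G) (y + w).
Proof.
move=> /zonotopeP[x x1 ->] [z z1 ->]; apply/zonotopeP.
by exists (col_mx x z); [exact: col_mx_norm_le1|rewrite mul_row_col addrA].
Qed.

End ZonotopeLemmas.

Section Inclusion.
Context {R : realType} {n m p q : nat}.
Variables (t0 tf : R) (A dA : R -> 'M[R]_n) (B dB : R -> 'M[R]_(n, m)).
Variables (MA MdA MB MdB : R) (phi phit : R -> R -> 'M[R]_n) (theta : R -> R).
Variables (a : 'cV[R]_n) (E : 'M[R]_(n, p)) (c : 'cV[R]_m) (G : 'M[R]_(m, q)).
Hypothesis t0_lt_tf : t0 < tf.
Hypothesis A_C1 : C1_on t0 tf A dA.
Hypothesis B_C1 : C1_on t0 tf B dB.
Hypothesis MA_gt0 : 0 < MA.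
Hypothesis A_le : forall t : R, t \in `[t0, tf] -> opnorm (A t) <= MA.
Hypothesis dA_le : forall t : R, t \in `[t0, tf] -> opnorm (dA t) <= MdA.
Hypothesis B_le : forall t : R, t \in `[t0, tf] -> opnorm (B t) <= MB.
Hypothesis dB_le : forall t : R, t \in `[t0, tf] -> opnorm (dB t) <= MdB.
Hypothesis phiP : is_transition_matrix A B t0 tf phi.
Hypothesis theta_ge0 : forall s : R, 0 <= s -> 0 <= theta s.
Hypothesis phit_close : forall t s : R, t0 <= s -> s <= t -> t <= tf ->
  opnorm (phi t s - phit t s) <= theta (t - s).

Variable N : nat.
Hypothesis N_gt0 : (0 < N)%N.

Let U := zonotope c G.
Notation h := (step t0 tf N).
Notation nd := (node t0 tf N).
Notation bFi := (bF t0 tf B phit theta MA MB MdB U a E c G N).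
Notation b_ i := (bFi i).1.
Notation F_ i := (bFi i).2.
Notation m_ := (m_norm t0 tf B phit theta MA MB MdB U a E c G N).
Notation Tr := (trans_step t0 tf phit N).
Notation alpha := (aux_alpha MA MB MdB U).
Notation beta := (aux_beta MdB U).
Notation gamma := (aux_gamma MA MdA).
Notation K := (set_norm U).

Lemma step_gt0 : 0 < h.
Proof. by rewrite divr_gt0 ?subr_gt0 // ltr0n. Qed.

Lemma nodeS i : nd i.+1 = nd i + h.
Proof. by rewrite /node -natr1 mulrDl mul1r addrA. Qed.

Lemma node0 : nd 0 = t0. Proof. by rewrite /node mul0r addr0. Qed.

Lemma nodeN : nd N = tf.
Proof. by rewrite /node /step mulrC divfK ?pnatr_eq0 -?lt0n // addrC subrK. Qed.

Lemma node_le i j : (i <= j)%N -> nd i <= nd j.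
Proof. by move=> ij; rewrite lerD2l ler_pM2r ?step_gt0 // ler_nat. Qed.

Lemma node_ge i : t0 <= nd i.
Proof. by have := node_le (leq0n i); rewrite node0. Qed.

Lemma node_le_tf i : (i <= N)%N -> nd i <= tf.
Proof. by move=> /node_le; rewrite nodeN. Qed.

Lemma node_cover t : t0 <= t -> t <= tf ->
  exists i, [/\ (i < N)%N, nd i <= t & t <= nd i.+1].
Proof.
move=> tt.
suff H k : (0 < k)%N -> t <= nd k -> exists i, [/\ (i < k)%N, nd i <= t & t <= nd i.+1].
  by have := H N N_gt0; rewrite nodeN.
elim: k => [//|[|k] IH] _ tk; first by exists 0%N; rewrite node0.
have [tk'|/ltW kt] := leP t (nd k.+1).
  by have [i [ik H1 H2]] := IH isT tk'; exists i; split=> //; exact: ltnW.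
by exists k.+1.
Qed.

Lemma enclosureE k l (x y : 'cV[R]_k * 'M[R]_(k, l)) :
  enclosure x y = enclosure (x.1, x.2) (y.1, y.2).
Proof. by case: x y => ? ? []. Qed.

Lemma bF_S i : bFi i.+1 =
  (Tr i.+1 *m b_ i + h *: (B (nd i.+1) *m c),
   row_mx (Tr i.+1 *m F_ i) (row_mx (K_mx t0 tf B G N i.+1)
     (alpha h + theta h * m_ i)%:M)).
Proof. by rewrite /m_norm /=; case: (bF _ _ _ _ _ _ _ _ _ _ _ _ _ _ i). Qed.

Lemma bF_point_norm i (z : 'cV[R]_(F_cols i)) :
  `|z| <= 1 -> `|b_ i + F_ i *m z| <= m_ i.
Proof. by move=> z1; apply: zonotope_norm_le; apply/zonotopeP; exists z. Qed.

Lemma K_ge0 : 0 <= K.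
Proof.
apply: le_trans (normr_ge0 c) _; apply: zonotope_set_norm.
by apply/zonotopeP; exists 0; rewrite ?normr0 // mulmx0 addr0.
Qed.

Lemma aux_r_mono s t : 0 <= s -> s <= t -> aux_r MA s <= aux_r MA t.
Proof.
move=> s0 st; rewrite /aux_r.
have -> : t * MA = s * MA + (t - s) * MA by ring.
rewrite expRD.
have H1 : 1 <= expR (s * MA) by rewrite -expR0 ler_expR mulr_ge0 // ltW.
have H2 : 1 + (t - s) * MA <= expR ((t - s) * MA) by exact: expR_ge1Dx.
have H3 : 0 <= (t - s) * MA by rewrite mulr_ge0 ?subr_ge0 // ltW.
by nra.
Qed.

Lemma aux_r_ge0 s : 0 <= s -> 0 <= aux_r MA s.
Proof.
move=> s0; have := aux_r_mono (lexx 0) s0.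
by rewrite {1}/aux_r mul0r expR0 !subrr.
Qed.

Lemma phit_close_mul s t (v : 'cV[R]_n) : t0 <= s -> s <= t -> t <= tf ->
  `|phi t s *m v - phit t s *m v| <= theta (t - s) * `|v|.
Proof.
move=> ts st tt; rewrite -mulmxBl; apply: le_trans (mulmx_norm_le _ _) _.
by rewrite ler_wpM2r // phit_close.
Qed.

Lemma solution_input_estimate t u x s t1 T : t <= tf ->
  admissible_input U t0 t u -> is_solution A B t0 t t0 (x t0) u x ->
  t0 <= s -> s <= t1 -> t1 <= t -> t1 <= T -> T <= tf ->
  exists2 xi : 'cV[R]_q, `|xi| <= 1 &
    `|x t1 - phi t1 s *m x s - (t1 - s) *: (B T *m (c + G *m xi))| <=
      alpha (t1 - s) + (T - t1) * (t1 - s) * MdB * K.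
Proof.
move=> ttf [uU _] sol ts st t1t t1T Ttf.
have [D nD HD] := solution_deriv sol.
apply: (input_estimate t0_lt_tf B_C1 MA_gt0 A_le dA_le B_le dB_le phiP ts st t1T Ttf _ _ nD (u := u)) => //.
- by move=> v; exact: zonotope_set_norm.
- by case: sol => + _ _; apply: ac_sub.
- move=> y sy yt; apply: uU; rewrite in_itv /= (le_trans ts sy).
  exact: le_trans yt _.
- by move=> y sy yt; apply: HD; [exact: le_trans sy|exact: le_trans yt _].
Qed.

(** The error made by replacing phi by phit and by freezing B at the right end of
    the cell is absorbed by the box generators of F. *)
Lemma node_state_in t u x i : t <= tf ->
  zonotope a E (x t0) -> admissible_input U t0 t u ->
  is_solution A B t0 t t0 (x t0) u x -> (i <= N)%N -> nd i <= t ->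
  exists2 z : 'cV[R]_(F_cols i), `|z| <= 1 & x (nd i) = b_ i + F_ i *m z.
Proof.
move=> ttf x0 adm sol; elim: i => [|i IH] iN it.
  by rewrite node0; apply/zonotopeP.
have ii := node_le (leqnSn i).
have [z z1 xE] := IH (ltnW iN) (le_trans ii it).
have tN := node_le_tf iN.
have hE : nd i.+1 - nd i = h by rewrite nodeS addrC addKr.
have [xi xi1] := solution_input_estimate ttf adm sol (node_ge i) ii it (lexx _) tN.
rewrite subrr !mul0r addr0 hE => H1.
have H2 := phit_close_mul (x (nd i)) (node_ge i) ii tN; rewrite hE in H2.
have H3 : `|x (nd i)| <= m_ i by rewrite xE; exact: bF_point_norm.
pose err := x (nd i.+1) - (phit (nd i.+1) (nd i) *m x (nd i)
  + h *: (B (nd i.+1) *m (c + G *m xi))).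
have [|zeta zeta1 errE] := @scalar_ball _ _ err (alpha h + theta h * m_ i).
  rewrite /err.
  rewrite [X in `|X|](_ : _ = (x (nd i.+1) - phi (nd i.+1) (nd i) *m x (nd i)
      - h *: (B (nd i.+1) *m (c + G *m xi)))
    + (phi (nd i.+1) (nd i) *m x (nd i) - phit (nd i.+1) (nd i) *m x (nd i))); last first.
    rewrite addrAC addrA subrK opprD addrA; by [].
  apply: le_trans (ler_normD _ _) _; apply: lerD => //; apply: le_trans H2 _.
  by rewrite ler_wpM2l // theta_ge0 // ltW // step_gt0.
exists (col_mx z (col_mx xi zeta)).
  by do !apply: col_mx_norm_le1 => //.
rewrite bF_S /= !mul_row_col -errE /err /K_mx /trans_step /= xE.
rewrite !mulmxDr -scalemxAl -!mulmxA scalerDr.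
move: (phit _ _ *m b_ i) (phit _ _ *m (F_ i *m z)) (h *: _) (h *: _) => y1 y2 y3 y4.
by apply/matrixP => k l; rewrite !mxE; ring.
Qed.

(** Between two nodes the state is the interpolation y1 of the enclosed end points,
    plus the input part with coordinate l xi, plus an error that is absorbed by the
    box generators of H. *)
Lemma reach_tube_subset :
  reach_tube A B t0 (zonotope a E) U t0 tf `<=`
    R_hat t0 tf B phit theta MA MdA MB MdB U a E c G N.
Proof.
move=> y [t /=]; rewrite in_itv /= => /andP[t0t ttf] [x0 [u [x [x0E adm sol ->]]]].
have xt0 : x t0 = x0 by case: sol.
rewrite -xt0 in x0E sol.
have [i [iN it ti]] := node_cover t0t ttf.
have ii := node_le (leqnSn i); have tN := node_le_tf iN.
exists i.+1 => //; rewrite /Lambda /H_mx.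
have [z z1 xE] := node_state_in ttf x0E adm sol (ltnW iN) it.
have h0 := step_gt0.
have hE : nd i.+1 - nd i = h by rewrite nodeS addrC addKr.
have ilt : nd i < nd i.+1 by rewrite -subr_gt0 hE.
set s := nd i in it ii xE hE ilt *; set T := nd i.+1 in ti ii tN hE ilt *.
pose l := (t - s) / h.
have l0 : 0 <= l by rewrite divr_ge0 ?subr_ge0 // ltW.
have l1 : l <= 1 by rewrite ler_pdivrMr // mul1r -hE lerD2r.
have lh : l * h = t - s by rewrite divfK // gt_eqF.
have t0s : t0 <= s := node_ge i.
have [xi xi1 H1] := solution_input_estimate ttf adm sol t0s it (lexx t) ti tN.
have H2 := phit_close_mul (x s) t0s ii tN; rewrite hE in H2.
have H3 : `|x s| <= m_ i by rewrite xE; exact: bF_point_norm.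
have lE : l = (t - s) / (T - s) by rewrite hE.
have H4 := phi_interpolation t0_lt_tf A_C1 MA_gt0 A_le dA_le B_le dB_le phiP (x s)
  t0s it ti tN ilt lE.
rewrite hE in H4.
have m0 : 0 <= m_ i := opnorm_ge0 _.
have th0 : 0 <= theta h by apply: theta_ge0; exact: ltW.
have [MdA0 MB0 MdB0] := bounds_ge0 t0_lt_tf dA_le B_le dB_le.
have g0 : 0 <= gamma h.
  rewrite mulr_ge0 ?aux_r_ge0 ?(ltW h0) // addr_ge0 // divr_ge0 //.
  by rewrite exprn_ge0 // ltW.
pose y1 := (1 - l) *: x s + l *: (phit T s *m x s + h *: (B T *m c)).
pose err := x t - y1 - l *: (h *: (B T *m (G *m xi))).
have Herr : `|err| <= alpha h + beta h + (gamma h + theta h) * m_ i.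
  rewrite [err](_ : _ = (x t - phi t s *m x s - (t - s) *: (B T *m (c + G *m xi)))
    + (phi t s *m x s - ((1 - l) *: x s + l *: (phi T s *m x s)))
    + l *: (phi T s *m x s - phit T s *m x s)); last first.
    rewrite -lh /err /y1 mulmxDr.
    move: (phi T s *m x s) (phit T s *m x s) (phi t s *m x s) => v1 v2 v3.
    move: (B T *m c) (B T *m (G *m xi)) => v4 v5.
    by apply/matrixP => k j; rewrite !mxE; ring.
  apply: le_trans (ler_normD _ _) _; rewrite mulrDl [leRHS]addrA; apply: lerD; last first.
    rewrite normrZ ger0_norm //; apply: le_trans (ler_wpM2l l0 H2) _.
    apply: (@le_trans _ _ (theta h * `|x s|)); last by rewrite ler_wpM2l.
    by rewrite ler_piMl // mulr_ge0.
  apply: le_trans (ler_normD _ _) _; apply: lerD; last first.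
    by apply: le_trans H4 _; rewrite ler_wpM2l.
  apply: le_trans H1 _.
  have ts0 : 0 <= t - s by rewrite subr_ge0.
  have tsh : t - s <= h by rewrite -hE lerD2r.
  apply: lerD.
    rewrite /aux_alpha; apply: ler_wpM2r.
      rewrite divr_ge0 ?exprn_ge0 ?(ltW MA_gt0) // addr_ge0 // mulr_ge0 //.
      exact: ltW.
    by apply: ler_wpM2r; [exact: K_ge0 | exact: aux_r_mono].
  rewrite /aux_beta ler_wpM2r ?K_ge0 // ler_wpM2r // expr2.
  by apply: ler_pM; rewrite ?subr_ge0 // -hE lerD2l lerN2.
have [zeta zeta1 errE] := scalar_ball Herr.
have -> : x t = y1 + (l *: (h *: (B T *m (G *m xi))) + err).
  by rewrite /err [_ + (x t - _ - _)]addrC subrK addrC subrK.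
apply: zonotope_row.
  rewrite /dJ /= enclosureE /y1 xE mulmxDr.
  rewrite (_ : _ + _ + h *: (B T *m c) = (bFi i.+1).1 + (Tr i.+1 *m (bFi i).2) *m z).
    exact: enclosure_segment.
  by rewrite bF_S /= mulmxA addrAC.
exists (col_mx (l *: xi) zeta).
  by apply: col_mx_norm_le1 => //; rewrite normrZ mulr_ile1 // ger0_norm.
by rewrite mul_row_col errE /K_mx -scalemxAr -scalemxAl mulmxA.
Qed.

End Inclusion.

(** * Solutions for piecewise constant inputs *)

Section Antiderivative.
Context {R : realType}.

Lemma lebesgue_measurable_fun_borel (D : set R) (f : R -> R) :
  measurable D -> measurable_fun D f -> lebesgue_measurable_fun D f.
Proof.
move=> mD mf _ Y mY; apply: sub_sigma_algebra.
exists (D `&` f @^-1` Y); first exact: mf.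
by exists set0; [exact: negligible_set0 | rewrite setU0].
Qed.

(** Entrywise fundamental theorem of calculus. Starting the integrals at a - 1
    makes every point of [a, b] interior to the domain of integration, so the
    derivative is two-sided there. *)
Lemma lipschitz_antiderivative k l (g : R -> 'M[R]_(k, l)) (a b K : R) :
  (forall s t (v : 'cV[R]_l), `|g s *m v - g t *m v| <= K * `|s - t| * `|v|) ->
  exists Psi : R -> 'M[R]_(k, l), forall t, a <= t -> t <= b ->
    is_derive t 1 Psi (g t).
Proof.
move=> Hg.
have gij s t i j : `|g s i j - g t i j| <= `|K| * `|s - t|.
  have := Hg s t (delta_mx j 0); rewrite -!colE => H.
  have := le_trans (cV_entry_le _ i) H; rewrite !mxE => /le_trans; apply.
  have d1 : `|delta_mx j 0 : 'cV[R]_l| <= 1.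
    apply/cV_norm_leP => // i'; rewrite mxE normr_nat.
    by case: (_ && _).
  apply: (@le_trans _ _ (`|K| * `|s - t| * `|delta_mx j 0 : 'cV[R]_l|)).
    by rewrite ler_wpM2r // ler_wpM2r // ler_norm.
  by rewrite ler_piMr // mulr_ge0.
have cg i j : continuous (fun s => g s i j).
  move=> s; apply/cvgrPdist_le => e e0.
  have K1 : 0 < `|K| + 1 by rewrite ltr_wpDl.
  apply/nbhs_ballP; exists (e / (`|K| + 1)); first by rewrite /= divr_gt0.
  move=> t; rewrite /ball /= => /ltW st.
  apply: le_trans (gij _ _ _ _) _.
  apply: (@le_trans _ _ ((`|K| + 1) * `|s - t|)).
    by rewrite ler_wpM2r // lerDl.
  by rewrite mulrC -ler_pdivlMr.
pose Psi s := \matrix_(i < k, j < l)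
  (\int[lebesgue_measure]_(y in `[a - 1, s]) g y i j)%R.
exists Psi => t at_ tb.
have H i j : derivable (fun s => Psi s i j) t 1 /\ 'D_1 (fun s => Psi s i j) t = g t i j.
  have := @continuous_FTC1_closed R (fun s => g s i j) (a - 1) t (t + 1).
  rewrite ltrDl ltr01 => /(_ isT).
  have -> : (a - 1 < t) by lra.
  move=> H0; have {H0} := H0 (continuous_compact_integrable (@segment_compact _ _ _)
    (continuous_subspaceT (cg i j))) isT (cg i j t).
  have -> : (fun s => Psi s i j) = (fun s => (\int[lebesgue_measure]_(y in `[a - 1, s]) g y i j)%R).
    by apply/funext => s; rewrite mxE.
  by rewrite derive1E.
have dP : derivable Psi t 1 by apply/derivable_mxP => i j; case: (H i j).
split=> //; rewrite derive_mx //.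
by apply/matrixP => i j; rewrite mxE; case: (H i j).
Qed.

(** Product rule, with the differentiability of the matrix factor expressed
    through its action on vectors. *)
Lemma deriv_within_mul k l (D : set R) (M : R -> 'M[R]_(k, l)) (y : R -> 'cV[R]_l)
    (t C : R) (d : 'cV[R]_k) (y' : 'cV[R]_l) :
  D t ->
  (forall s (v : 'cV[R]_l), D s -> `|M s *m v - M t *m v| <= C * `|s - t| * `|v|) ->
  deriv_within D (fun s => M s *m y t) t d ->
  deriv_within D y t y' ->
  deriv_within D (fun s => M s *m y s) t (d + M t *m y').
Proof.
move=> Dt HM Hd Hy e e0.
have e3 : 0 < e / 3 by rewrite divr_gt0.
pose c1 := opnorm (M t) + 1; have c10 : 0 < c1 by rewrite ltr_wpDl ?opnorm_ge0.
pose c2 := (`|C| + 1) * (`|y'| + 1).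
have c20 : 0 < c2 by rewrite mulr_gt0 // ltr_wpDl.
have [d1 d10 K1] := Hd _ e3.
have [d2 d20 K2] := Hy _ (divr_gt0 e3 c10).
have [d3 d30 K3] := Hy 1 ltr01.
exists (Num.min (Num.min d1 d2) (Num.min d3 (e / 3 / c2))).
  by rewrite !lt_min d10 d20 d30 divr_gt0.
move=> s Ds; rewrite !lt_min => /andP[/andP[s1 s2] /andP[s3 s4]].
have {K1} H1 := K1 s Ds s1; have {K2} H2 := K2 s Ds s2; have {K3} H3 := K3 s Ds s3.
rewrite mul1r in H3.
have H4 : `|y s - y t| <= (`|y'| + 1) * `|s - t|.
  have -> : y s - y t = (y s - y t - (s - t) *: y') + (s - t) *: y' by rewrite subrK.
  apply: le_trans (ler_normD _ _) _; rewrite normrZ.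
  by apply: le_trans (lerD H3 (lexx _)) _; lra.
rewrite [X in `|X|](_ : _ = (M s *m y t - M t *m y t - (s - t) *: d)
  + M t *m (y s - y t - (s - t) *: y')
  + (M s *m (y s - y t) - M t *m (y s - y t))); last first.
  rewrite !mulmxBr scalerDr -scalemxAr.
  move: (M s *m y s) (M s *m y t) (M t *m y s) (M t *m y t) (M t *m y').
  by move=> v1 v2 v3 v4 v5; apply/matrixP => i j; rewrite !mxE; ring.
apply: le_trans (ler_normD _ _) _.
have -> : e * `|s - t| = e / 3 * `|s - t| + e / 3 * `|s - t| + e / 3 * `|s - t| by field.
apply: lerD.
  apply: le_trans (ler_normD _ _) _; apply: lerD => //.
  apply: le_trans (mulmx_norm_le _ _) _.
  apply: (@le_trans _ _ (c1 * (e / 3 / c1 * `|s - t|))).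
    by apply: ler_pM; rewrite ?opnorm_ge0 // lerDl.
  by rewrite mulrA [c1 * _]mulrC divfK // gt_eqF.
apply: le_trans (HM _ _ Ds) _.
apply: (@le_trans _ _ ((`|C| + 1) * `|s - t| * ((`|y'| + 1) * `|s - t|))).
  apply: (@le_trans _ _ ((`|C| + 1) * `|s - t| * `|y s - y t|)).
    by rewrite ler_wpM2r // ler_wpM2r // (le_trans (ler_norm _)) // lerDl.
  by rewrite ler_wpM2l // mulr_ge0 // addr_ge0.
rewrite mulrACA -/c2 mulrCA mulrA ler_wpM2r // -ler_pdivlMr //.
exact: ltW.
Qed.

End Antiderivative.

Section Existence.
Context {R : realType} {n m : nat}.
Variables (t0 tf : R) (A dA : R -> 'M[R]_n) (B dB : R -> 'M[R]_(n, m)).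
Variables (MA MdA MB MdB : R) (phi : R -> R -> 'M[R]_n).
Hypothesis t0_lt_tf : t0 < tf.
Hypothesis A_C1 : C1_on t0 tf A dA.
Hypothesis B_C1 : C1_on t0 tf B dB.
Hypothesis MA_gt0 : 0 < MA.
Hypothesis A_le : forall t : R, t \in `[t0, tf] -> opnorm (A t) <= MA.
Hypothesis dA_le : forall t : R, t \in `[t0, tf] -> opnorm (dA t) <= MdA.
Hypothesis B_le : forall t : R, t \in `[t0, tf] -> opnorm (B t) <= MB.
Hypothesis dB_le : forall t : R, t \in `[t0, tf] -> opnorm (dB t) <= MdB.
Hypothesis phiP : is_transition_matrix A B t0 tf phi.

Let t0tf : t0 <= tf := ltW t0_lt_tf.
Let Emax := expR (MA * (tf - t0)).

Let Emax_ge t : t <= tf -> expR (MA * (t - t0)) <= Emax.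
Proof. by move=> ttf; rewrite ler_expR ler_pM2l // lerD2r. Qed.

Lemma phi_bound0 t (p : 'cV[R]_n) : t0 <= t -> t <= tf ->
  `|phi t t0 *m p| <= Emax * `|p|.
Proof.
move=> tt ttf; apply: le_trans (phi_bound MA_gt0 A_le phiP p (lexx t0) tt ttf) _.
by rewrite mulrC ler_wpM2r // Emax_ge.
Qed.

Lemma phi_lipschitz t t' (p : 'cV[R]_n) : t0 <= t -> t <= tf -> t0 <= t' -> t' <= tf ->
  `|phi t' t0 *m p - phi t t0 *m p| <= MA * Emax * `|t' - t| * `|p|.
Proof.
wlog tt' : t t' / t <= t'.
  move=> H ? ? ? ?; have [|/ltW] := leP t t'; first by move=> ?; apply: H.
  by move=> ?; rewrite distrC [`|t' - t|]distrC; apply: H.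
move=> tt ttf tt0 ttf'.
apply: le_trans (phi_incr MA_gt0 A_le phiP p (lexx t0) tt tt' ttf') _.
rewrite mulrC ler_wpM2r // ger0_norm ?subr_ge0 //.
have -> : MA * (t - t0) = MA * (t' - t0) + MA * (t - t') by ring.
rewrite expRD -{1}[expR (MA * (t' - t0))]mulr1 -mulrBr.
apply: (@le_trans _ _ (expR (MA * (t' - t0)) * (MA * (t' - t)))).
  rewrite ler_wpM2l ?expR_ge0 //.
  by have := expR_ge1Dx (MA * (t - t')); lra.
rewrite mulrCA -mulrA ler_wpM2l ?(ltW MA_gt0) // ler_wpM2r ?subr_ge0 //.
exact: Emax_ge.
Qed.

Lemma phi_deriv_all t (p : 'cV[R]_n) : t0 <= t -> t <= tf ->
  deriv_within `[t0, tf]%classic (fun s => phi s t0 *m p) t (A t *m (phi t t0 *m p)).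
Proof.
move=> tt ttf e e0.
have [MdA0 _ _] := bounds_ge0 t0_lt_tf dA_le B_le dB_le.
pose c := (MA + MdA / MA) * `|p| / MA.
have c0 : 0 <= c by rewrite divr_ge0 ?mulr_ge0 ?addr_ge0 ?divr_ge0 // ltW.
have c1 : 0 < c + 1 by rewrite ltr_wpDl.
have /is_deriveP/(_ _ (divr_gt0 e0 c1))[d d0 K] := is_derive_expR_lin MA t0 t.
exists d => // s /=; rewrite in_itv /= => /andP[ts stf] std.
apply: le_trans (phi_taylor t0_lt_tf A_C1 MA_gt0 A_le dA_le B_le dB_le phiP p
  (lexx t0) tt ts ttf stf) _.
have := K s I std; rewrite /GRing.scale /=; set X := _ - _ - _ => HX.
rewrite (_ : _ * _ = c * X); last by rewrite /c /X; field; rewrite gt_eqF.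
apply: (@le_trans _ _ ((c + 1) * `|X|)).
  by apply: le_trans (ler_wpM2l c0 (ler_norm X)) _; rewrite ler_wpM2r // lerDl.
rewrite -ler_pdivlMl //; apply: le_trans HX _.
by rewrite mulrA [_^-1 * e]mulrC.
Qed.

Lemma vector_act_id k (M : 'M[R]_k) : (forall p : 'cV[R]_k, M *m p = p) -> M = 1%:M.
Proof.
move=> H; apply/matrixP => i j.
have := H (delta_mx j 0); rewrite -colE => /matrixP/(_ i 0); rewrite !mxE => ->.
by rewrite eqxx andbT.
Qed.

(** For every p the functions phi(., s) p and phi(., t0) phi(t0, s) p solve the
    homogeneous equation with the same value at t0; forward uniqueness and
    evaluation at s give the claim. *)
Lemma phi_inv s : t0 <= s -> s <= tf -> phi t0 s *m phi s t0 = 1%:M.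
Proof.
move=> ts stf; apply: mulmx1C; apply: vector_act_id => p; rewrite -mulmxA.
set q := phi t0 s *m p.
have [E nE HE] := phi_deriv phiP p ts stf.
have [F nF HF] := phi_deriv phiP q (lexx t0) t0tf.
pose w t := phi t s *m p - phi t t0 *m q.
have acw : absolutely_continuous_on t0 tf w by exact: acB (phi_ac phiP p ts stf) (phi_ac phiP q (lexx t0) t0tf).
have := @gronwall R n (E `|` F) t0 tf MA 0 w MA_gt0 (lexx _) t0tf acw (negligibleU nE nF).
have w0 : w t0 = 0 by rewrite /w (phi_id phiP) // subrr.
rewrite w0 normr0 => /(_ _ s ts stf).
rewrite mul0r mul0r add0r mul0r normr_le0 /w (phi_id phiP) // => H.
apply/eqP; rewrite eq_sym -subr_eq0; apply: H => t tt ttf /not_orP[nEt nFt].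
exists (A t *m w t); last by rewrite addr0; exact: (A_mul_le A_le).
apply: (@deriv_within_sub _ _ setT) => //.
rewrite /w mulmxBr.
apply/is_deriveP; apply: is_deriveB; apply/is_deriveP; [exact: HE|exact: HF].
Qed.

(** Near t the inverse is bounded by twice its norm at t, because phi(., t0) is
    Lipschitz; Cousin's lemma makes the bound uniform. *)
Lemma phi_inv_bound : exists2 K, 0 <= K &
  forall s (v : 'cV[R]_n), t0 <= s -> s <= tf -> `|phi t0 s *m v| <= K * `|v|.
Proof.
pose Q s t := exists2 K, 0 <= K &
  forall y (v : 'cV[R]_n), s <= y -> y <= t -> `|phi t0 y *m v| <= K * `|v|.
suff [K K0 HK] : Q t0 tf by exists K.
apply: cousin => //.
- move=> s t r _ _ _ _ [K K0 HK] [K' K0' HK']; exists (K + K'); first exact: addr_ge0.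
  move=> y v sy yr; rewrite mulrDl; have [yt|/ltW ty] := leP y t.
    by apply: le_trans (HK y v sy yt) _; rewrite lerDl mulr_ge0.
  by apply: le_trans (HK' y v ty yr) _; rewrite lerDr mulr_ge0.
- move=> t tt ttf; pose c := opnorm (phi t0 t).
  have c0 : 0 <= c := opnorm_ge0 _.
  pose L := MA * Emax.
  have L0 : 0 <= L by rewrite mulr_ge0 ?expR_ge0 // ltW.
  have k0 : 0 < 2 * (c * L + 1) by rewrite mulr_gt0 // ltr_wpDl // mulr_ge0.
  exists (2 * (c * L + 1))^-1; first by rewrite invr_gt0.
  move=> s r as_ st tr rb tsd rtd; exists (2 * c); first by rewrite mulr_ge0.
  move=> y v sy yr; have ty := le_trans as_ sy; have ytf := le_trans yr rb.
  set w := phi t0 y *m v.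
  have wE : w = phi t0 t *m (v - (phi y t0 *m w - phi t t0 *m w)).
    have -> : phi y t0 *m w = v by rewrite /w mulmxA (mulmx1C (phi_inv ty ytf)) mul1mx.
    by rewrite opprB addrC subrK mulmxA (phi_inv tt ttf) mul1mx.
  have yt : `|y - t| <= (2 * (c * L + 1))^-1 by rewrite ler_norml; lra.
  have H1 := phi_lipschitz w tt ttf ty ytf.
  have H2 : `|w| <= c * (`|v| + L * `|y - t| * `|w|).
    rewrite {1}wE; apply: le_trans (mulmx_norm_le _ _) _; rewrite ler_wpM2l //.
    by apply: le_trans (ler_normB _ _) _; rewrite lerD2l.
  have H3 : c * L * `|y - t| <= 2^-1.
    apply: (@le_trans _ _ ((c * L + 1) * (2 * (c * L + 1))^-1)).
      by apply: ler_pM => //; [exact: mulr_ge0 | rewrite lerDl].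
    rewrite le_eqVlt; apply/orP; left; apply/eqP; field.
    by rewrite gt_eqF // ltr_wpDl // mulr_ge0.
  have : c * L * `|y - t| * `|w| <= 2^-1 * `|w| by rewrite ler_wpM2r.
  by lra.
Qed.

(** The integrand phi(t0, s) B(s) of the variation of constants formula is
    Lipschitz, since the inverse of a bounded Lipschitz family with bounded
    inverses is Lipschitz. *)
Lemma input_antiderivative : exists (Psi : R -> 'M[R]_(n, m)) (K : R), 0 <= K /\
  (forall t, t0 <= t -> t <= tf -> is_derive t (1 : R) Psi (phi t0 t *m B t)) /\
  (forall s t (v : 'cV[R]_m), t0 <= s -> s <= t -> t <= tf ->
     `|(Psi t - Psi s) *m v| <= K * (t - s) * `|v|).
Proof.
have [K K0 HK] := phi_inv_bound.
have [MdA0 MB0 MdB0] := bounds_ge0 t0_lt_tf dA_le B_le dB_le.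
pose g s := phi t0 s *m B s.
pose L := K * (MA * Emax) * K * MB + K * MdB.
have MAE : 0 <= MA * Emax by rewrite mulr_ge0 ?expR_ge0 // ltW.
have L0 : 0 <= L.
  by apply: addr_ge0; [do 2! apply: mulr_ge0 => //; exact: mulr_ge0 | exact: mulr_ge0].
have gB s (v : 'cV[R]_m) : t0 <= s -> s <= tf -> `|g s *m v| <= K * MB * `|v|.
  move=> ts stf; rewrite /g -mulmxA -mulrA; apply: le_trans (HK _ _ ts stf) _.
  by rewrite ler_wpM2l //; exact: (B_mul_le B_le).
have gL s t (v : 'cV[R]_m) : t0 <= s -> s <= t -> t <= tf ->
    `|g s *m v - g t *m v| <= L * (t - s) * `|v|.
  move=> ts st ttf; have stf := le_trans st ttf; have tt := le_trans ts st.
  rewrite /g -!mulmxA.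
  have phiK (y : R) (z : 'cV[R]_n) : t0 <= y -> y <= tf -> phi t0 y *m (phi y t0 *m z) = z.
    by move=> ? ?; rewrite mulmxA phi_inv // mul1mx.
  have phiKV (y : R) (z : 'cV[R]_n) : t0 <= y -> y <= tf -> phi y t0 *m (phi t0 y *m z) = z.
    by move=> ? ?; rewrite mulmxA (mulmx1C (phi_inv _ _)) // mul1mx.
  rewrite -normrN opprB.
  rewrite [X in `|X|](_ : _ = phi t0 t *m ((B t - B s) *m v)
    - phi t0 t *m (phi t t0 *m (phi t0 s *m (B s *m v))
                   - phi s t0 *m (phi t0 s *m (B s *m v)))); last first.
    rewrite !mulmxBl !mulmxBr phiK // phiKV //.
    by rewrite opprB addrA subrK.
  apply: le_trans (ler_normB _ _) _; rewrite [L]addrC !mulrDl; apply: lerD.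
    apply: le_trans (HK _ _ tt ttf) _; rewrite -!mulrA ler_wpM2l // mulrA.
    exact: C1_lipschitz B_C1.1 dB_le _ _ _ _ _ _.
  apply: le_trans (HK _ _ tt ttf) _; rewrite -!mulrA ler_wpM2l //.
  apply: le_trans (phi_lipschitz _ ts stf tt ttf) _.
  rewrite [`|t - s|]ger0_norm ?subr_ge0 //.
  rewrite [leRHS](_ : _ = MA * Emax * (t - s) * (K * (MB * `|v|))); last by ring.
  rewrite ler_wpM2l ?mulr_ge0 ?subr_ge0 //.
    exact: ltW. exact: expR_ge0.
  apply: le_trans (HK _ _ ts stf) _; rewrite ler_wpM2l //.
  exact: (B_mul_le B_le).
(* Clamping to [t0, tf] extends the integrand to a Lipschitz function on R. *)
pose cl s := Num.max t0 (Num.min s tf).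
have cl1 s : t0 <= cl s by rewrite le_max lexx.
have cl2 s : cl s <= tf by rewrite ge_max t0tf ge_min lexx orbT.
have clE s : t0 <= s -> s <= tf -> cl s = s.
  by move=> ts stf; rewrite /cl (min_l stf) (max_r ts).
have clL s t : s <= t -> 0 <= cl t - cl s <= t - s.
  move=> st; rewrite /cl /Num.max /Num.min.
  by do !case: ifPn; rewrite -?leNgt => *; lra.
have [s t v|Psi HPsi] := @lipschitz_antiderivative R n m (g \o cl) t0 tf L.
  wlog st : s t / s <= t.
    move=> H; have [|/ltW] := leP s t; first exact: H.
    by move=> ts; rewrite distrC [`|s - t|]distrC; exact: H.
  have /andP[c0 c1] := clL s t st.
  apply: le_trans (gL _ _ v (cl1 s) _ (cl2 t)) _; first by rewrite -subr_ge0.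
  by rewrite ler_wpM2r // ler_wpM2l // distrC ger0_norm // subr_ge0.
have dPsi t : t0 <= t -> t <= tf -> is_derive t (1 : R) Psi (g t).
  by move=> tt ttf; have := HPsi t tt ttf; rewrite /= clE.
exists Psi, (K * MB); split; first exact: mulr_ge0.
split; first exact: dPsi.
apply: (@C1_lipschitz _ _ _ _ _ _ _ g).
  apply/has_deriv_onP => t; rewrite in_itv /= => /andP[tt ttf].
  by apply: (@deriv_within_sub _ _ setT) => //; apply/is_deriveP; exact: dPsi.
move=> t; rewrite in_itv /= => /andP[tt ttf]; apply: opnorm_le; first exact: mulr_ge0.
move=> v v1; apply: le_trans (gB _ _ tt ttf) _.
by rewrite ler_piMr // mulr_ge0.
Qed.

End Existence.

Section PiecewiseConstant.
Context {R : realType} {n m : nat}.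
Variables (t0 tf : R) (A dA : R -> 'M[R]_n) (B dB : R -> 'M[R]_(n, m)).
Variables (MA MdA MB MdB : R) (phi : R -> R -> 'M[R]_n).
Hypothesis t0_lt_tf : t0 < tf.
Hypothesis A_C1 : C1_on t0 tf A dA.
Hypothesis B_C1 : C1_on t0 tf B dB.
Hypothesis MA_gt0 : 0 < MA.
Hypothesis A_le : forall t : R, t \in `[t0, tf] -> opnorm (A t) <= MA.
Hypothesis dA_le : forall t : R, t \in `[t0, tf] -> opnorm (dA t) <= MdA.
Hypothesis B_le : forall t : R, t \in `[t0, tf] -> opnorm (B t) <= MB.
Hypothesis dB_le : forall t : R, t \in `[t0, tf] -> opnorm (dB t) <= MdB.
Hypothesis phiP : is_transition_matrix A B t0 tf phi.
Variable N : nat.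
Hypothesis N_gt0 : (0 < N)%N.

Notation h := (step t0 tf N).
Notation nd := (node t0 tf N).

Let h_gt0 : 0 < h := step_gt0 t0_lt_tf N_gt0.
Let t0tf : t0 <= tf := ltW t0_lt_tf.

(** Takes the value v i on the half-open grid interval from node i to node i + 1. *)
Definition pw_input (v : nat -> 'cV[R]_m) (t : R) : 'cV[R]_m :=
  v (Num.truncn ((t - t0) / h)).

Lemma pw_input_eq v i t : nd i <= t -> t < nd i.+1 -> pw_input v t = v i.
Proof.
move=> it ti; congr (v _); apply: truncn_def.
rewrite ler_pdivlMr // ltr_pdivrMr //.
by move: it ti; rewrite /node lerBrDl ltrBlDl => -> ->.
Qed.

Lemma node_inv t : t0 <= t -> exists2 i, nd i <= t & t < nd i.+1.
Proof.
move=> tt; exists (Num.truncn ((t - t0) / h)).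
  have : (0 : R) <= (t - t0) / h by rewrite divr_ge0 ?subr_ge0 // ltW.
  move=> /truncn_itv/andP[+ _]; rewrite ler_pdivlMr // /node.
  by rewrite lerBrDl.
have : (0 : R) <= (t - t0) / h by rewrite divr_ge0 ?subr_ge0 // ltW.
move=> /truncn_itv/andP[_]; rewrite ltr_pdivrMr // /node.
by rewrite ltrBlDl.
Qed.

Lemma pw_input_admissible (U : set 'cV[R]_m) v t :
  (forall i, U (v i)) -> admissible_input U t0 t (pw_input v).
Proof.
move=> vU; split=> [s _|j]; first exact: vU.
apply: lebesgue_measurable_fun_borel => //.
move=> mD Y mY.
rewrite [X in measurable X](_ : _ =
    \bigcup_(i in [set i | Y (v i j 0)]) (`[t0, t] `&` `[nd i, nd i.+1[)%classic).
  by apply: bigcup_measurable => i _; exact: measurableI.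
apply/seteqP; split=> s /=.
  move=> [sD sY]; have : t0 <= s by move: sD; rewrite /= in_itv /= => /andP[].
  move=> /node_inv[i is_ si]; exists i => /=.
    by rewrite -(pw_input_eq v is_ si).
  by split=> //=; rewrite in_itv /= is_ si.
move=> [i /= iY [sD]]; rewrite in_itv /= => /andP[is_ si]; split=> //.
by rewrite (pw_input_eq v is_ si).
Qed.

Let clip i t := Num.max (nd i) (Num.min t (nd i.+1)).

Let clip_ge i t : nd i <= clip i t. Proof. by rewrite le_max lexx. Qed.

Let clip_le i t : clip i t <= nd i.+1.
Proof. by rewrite ge_max (node_le t0_lt_tf N_gt0 (leqnSn i)) ge_min lexx orbT. Qed.

Let clip_lip i s t : s <= t -> 0 <= clip i t - clip i s <= t - s.
Proof.
have := node_le t0_lt_tf N_gt0 (leqnSn i); rewrite /clip => ii st.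
rewrite /Num.max /Num.min; do !case: ifPn; rewrite -?leNgt => *; lra.
Qed.

Let clip_id i t : nd i <= t -> t <= nd i.+1 -> clip i t = t.
Proof. by move=> it ti; rewrite /clip (min_l ti) (max_r it). Qed.

Let clip_left i t : t <= nd i -> clip i t = nd i.
Proof.
move=> ti; have := node_le t0_lt_tf N_gt0 (leqnSn i) => ii.
by rewrite /clip (min_l (le_trans ti ii)) (max_l ti).
Qed.

Let clip_right i t : nd i.+1 <= t -> clip i t = nd i.+1.
Proof.
move=> ti; have := node_le t0_lt_tf N_gt0 (leqnSn i) => ii.
by rewrite /clip (min_r ti) (max_r ii).
Qed.

(** Variation of constants, cell by cell. Causality, the second part, allows the
    input to be chosen one cell at a time. *)
Lemma pw_solution : exists sol : 'cV[R]_n -> (nat -> 'cV[R]_m) -> R -> 'cV[R]_n,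
  (forall x0 v, is_solution A B t0 tf t0 x0 (pw_input v) (sol x0 v)) /\
  (forall x0 v v' i, (forall k, (k < i)%N -> v k = v' k) ->
     sol x0 v (nd i) = sol x0 v' (nd i)).
Proof.
(* With the time clipped to cell k, the k-th summand of y integrates the input
   over that cell only: it vanishes before the cell and is constant after it. *)
have [Psi [K [K0 [dPsi PsiL]]]] :=
  input_antiderivative t0_lt_tf B_C1 MA_gt0 A_le dA_le B_le dB_le phiP.
pose y x0 (v : nat -> 'cV[R]_m) t :=
  x0 + \sum_(k < N) (Psi (clip k t) - Psi (nd k)) *m v k.
exists (fun x0 v t => phi t t0 *m y x0 v t); split; last first.
  move=> x0 v v' i vv'; congr (_ *m (_ + _)); apply: eq_bigr => k _.
  have [ki|ik] := ltnP k i; first by rewrite vv'.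
  by rewrite clip_left ?(node_le t0_lt_tf) // subrr !mul0mx.
move=> x0 v.
have clip_t0 k t : t0 <= clip k t.
  by apply: le_trans (clip_ge k t); exact: node_ge.
have clip_tf (k : 'I_N) t : clip k t <= tf.
  by apply: le_trans (clip_le k t) _; exact: node_le_tf.
pose Y := \sum_(k < N) K * `|v k|.
have Y0 : 0 <= Y by apply: sumr_ge0 => k _; exact: mulr_ge0.
have yL s t : s <= t -> `|y x0 v t - y x0 v s| <= Y * (t - s).
  move=> st; rewrite /y opprD addrACA subrr add0r -sumrB mulr_suml.
  apply: le_trans (ler_norm_sum _ _ _) _; apply: ler_sum => k _.
  rewrite -mulmxBl opprB addrA subrK.
  have /andP[c0 c1] := clip_lip k st.
  apply: le_trans (PsiL _ _ _ (clip_t0 k s) _ (clip_tf k t)) _.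
    by rewrite -subr_ge0.
  by rewrite mulrAC ler_wpM2l // mulr_ge0.
have y0 : y x0 v t0 = x0.
  rewrite /y big1 ?addr0 // => k _.
  by rewrite clip_left ?subrr ?mul0mx //; exact: node_ge.
pose Em := expR (MA * (tf - t0)).
have Em0 : 0 <= Em := expR_ge0 _.
split.
- apply: (@lipschitz_ac _ _ _ _ (Em * Y + MA * Em * (`|x0| + Y * (tf - t0)))) => s t ts st ttf.
  have stf := le_trans st ttf; have tt := le_trans ts st.
  rewrite [X in `|X|](_ : _ = phi t t0 *m (y x0 v t - y x0 v s)
    + (phi t t0 *m y x0 v s - phi s t0 *m y x0 v s)); last first.
    by rewrite mulmxBr addrA subrK.
  apply: le_trans (ler_normD _ _) _; rewrite mulrDl; apply: lerD.
    apply: le_trans (phi_bound0 MA_gt0 A_le phiP _ tt ttf) _.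
    by rewrite -mulrA ler_wpM2l // yL.
  apply: le_trans (phi_lipschitz MA_gt0 A_le phiP _ ts stf tt ttf) _.
  rewrite ger0_norm ?subr_ge0 // mulrAC ler_wpM2r ?subr_ge0 //.
  rewrite ler_wpM2l ?mulr_ge0 ?(ltW MA_gt0) //.
  have -> : y x0 v s = y x0 v t0 + (y x0 v s - y x0 v t0) by rewrite addrC subrK.
  apply: le_trans (ler_normD _ _) _; rewrite {1}y0 lerD2l.
  by apply: le_trans (yL _ _ ts) _; rewrite ler_wpM2l // lerD2r.
- by rewrite (phi_id phiP) // y0.
have nN : (@lebesgue_measure R).-negligible (\bigcup_i [set nd i]).
  apply: negligible_bigcup => i; apply/negligibleP => //.
  exact: lebesgue_measure_set1.
apply: negligibleS nN => t /=; apply: contra_notP => nt.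
rewrite in_itv /= => /andP[tt ttf].
have [i [iN it ti]] := node_cover N_gt0 tt ttf.
have {}it : nd i < t.
  by rewrite lt_neqAle it andbT; apply/eqP => e; apply: nt; exists i.
have {}ti : t < nd i.+1.
  by rewrite lt_neqAle ti andbT; apply/eqP => e; apply: nt; exists i.+1.
have ttf' : t < tf by apply: lt_le_trans ti _; exact: node_le_tf.
have tt' : t0 < t by apply: le_lt_trans it; exact: node_ge.
have yi s : nd i <= s -> s <= nd i.+1 -> y x0 v s - y x0 v t = (Psi s - Psi t) *m v i.
  move=> is_ si; rewrite /y opprD addrACA subrr add0r -sumrB.
  rewrite (bigD1 (Ordinal iN)) //= big1 ?addr0 => [|k ki].
    rewrite -mulmxBl opprB addrA subrK !clip_id //; exact: ltW.
  rewrite -mulmxBl opprB addrA subrK.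
  have {}ki : (k != i :> nat) by apply: contra ki => /eqP e; apply/eqP/val_inj.
  case: (ltngtP k i) ki => // [kI|Ik] _.
    by rewrite !clip_right ?subrr ?mul0mx //; [apply: le_trans (ltW it)|apply: le_trans is_]; exact: node_le.
  by rewrite !clip_left ?subrr ?mul0mx //; [apply: le_trans (ltW ti) _|apply: le_trans si _]; exact: node_le.
pose D := `[t0, tf]%classic : set R.
have Dt : D t by rewrite /D /= in_itv /= tt ttf.
have dy : deriv_within D (y x0 v) t (phi t0 t *m B t *m v i).
  have /is_deriveP/(deriv_within_mulmx (v i)) H := dPsi t tt ttf.
  move=> e e0; have [d d0 Hd] := H e e0.
  exists (Num.min d (Num.min (t - nd i) (nd i.+1 - t))).
    by rewrite !lt_min d0 !subr_gt0 it ti.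
  move=> s Ds; rewrite !lt_min => /andP[sd]; rewrite !ltr_norml => /andP[/andP[s1 _] /andP[_ s2]].
  rewrite yi; [|lra|lra].
  by rewrite mulmxBl; exact: Hd.
have H : deriv_within D (fun s => phi s t0 *m y x0 v s) t
    (A t *m (phi t t0 *m y x0 v t) + phi t t0 *m (phi t0 t *m B t *m v i)).
  apply: (@deriv_within_mul _ _ _ D (fun s => phi s t0) (y x0 v) t (MA * Em)) => //.
    move=> s z; rewrite /D /= in_itv /= => /andP[ts stf].
    exact: (phi_lipschitz MA_gt0 A_le phiP).
  exact: (phi_deriv_all t0_lt_tf A_C1 MA_gt0 A_le dA_le B_le dB_le phiP).
apply/is_deriveP; rewrite (pw_input_eq v (ltW it) ti).
rewrite (_ : B t *m v i = phi t t0 *m (phi t0 t *m B t *m v i)); last first.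
  rewrite !mulmxA (mulmx1C (phi_inv t0_lt_tf MA_gt0 A_le phiP tt ttf)).
  by rewrite mul1mx.
move=> e e0; have [d d0 Hd] := H e e0.
exists (Num.min d (Num.min (t - t0) (tf - t))).
  by rewrite !lt_min d0 !subr_gt0 tt' ttf'.
move=> s _; rewrite !lt_min => /andP[sd]; rewrite !ltr_norml => /andP[/andP[s1 _] /andP[_ s2]].
apply: Hd => //; rewrite /D /= in_itv /=; lra.
Qed.

End PiecewiseConstant.

(** * First order convergence *)

Section Growth.
Context {R : realType}.

Lemma discrete_gronwall (N : nat) (f : nat -> R) (a b : R) :
  0 <= a -> 0 <= b -> 0 <= f 0%N ->
  (forall i, (i < N)%N -> f i.+1 <= (1 + a) * f i + b) ->
  forall i, (i <= N)%N -> f i <= expR (i%:R * a) * (f 0%N + i%:R * b).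
Proof.
move=> a0 b0 f0 H; elim=> [_|i IH iN].
  by rewrite !mul0r expR0 mul1r addr0.
apply: le_trans (H i iN) _; have {}IH := IH (ltnW iN).
have -> : i.+1%:R * a = a + i%:R * a by rewrite -natr1; ring.
have -> : i.+1%:R * b = i%:R * b + b by rewrite -natr1; ring.
set Y := expR (i%:R * a) * (f 0%N + i%:R * b) in IH.
have Y0 : 0 <= Y by rewrite mulr_ge0 ?expR_ge0 // addr_ge0 // mulr_ge0.
have -> : expR (a + i%:R * a) * (f 0%N + (i%:R * b + b)) =
    expR a * Y + expR (a + i%:R * a) * b by rewrite /Y expRD; ring.
apply: lerD.
  apply: (@le_trans _ _ ((1 + a) * Y)); first by rewrite ler_wpM2l // addr_ge0.
  by rewrite ler_wpM2r // expR_ge1Dx.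
by rewrite ler_peMl // -expR0 ler_expR addr_ge0 // mulr_ge0.
Qed.

Lemma expR_sub1_le (x : R) : expR x - 1 <= x * expR x.
Proof.
have := expR_ge1Dx (- x); rewrite -(ler_pM2r (expR_gt0 x)) -expRD addNr expR0.
by lra.
Qed.

Lemma expR_taylor1_le (x : R) : 0 <= x -> expR x - 1 - x <= x ^+ 2 * expR x.
Proof.
move=> x0; have := ler_wpM2l x0 (expR_sub1_le x); have := expR_sub1_le x.
by rewrite expr2; lra.
Qed.

Lemma half_difference k (b x : 'cV[R]_k) : x = 2^-1 *: ((b + x) - (b - x)).
Proof. by apply/matrixP => i j; rewrite !mxE; field. Qed.

End Growth.

Section Convergence.
Context {R : realType} {n m p q : nat}.
Variables (t0 tf : R) (A dA : R -> 'M[R]_n) (B dB : R -> 'M[R]_(n, m)).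
Variables (MA MdA MB MdB : R) (phi phit : R -> R -> 'M[R]_n) (theta : R -> R).
Variables (a : 'cV[R]_n) (E : 'M[R]_(n, p)) (c : 'cV[R]_m) (G : 'M[R]_(m, q)).
Hypothesis t0_lt_tf : t0 < tf.
Hypothesis A_C1 : C1_on t0 tf A dA.
Hypothesis B_C1 : C1_on t0 tf B dB.
Hypothesis MA_gt0 : 0 < MA.
Hypothesis A_le : forall t : R, t \in `[t0, tf] -> opnorm (A t) <= MA.
Hypothesis dA_le : forall t : R, t \in `[t0, tf] -> opnorm (dA t) <= MdA.
Hypothesis B_le : forall t : R, t \in `[t0, tf] -> opnorm (B t) <= MB.
Hypothesis dB_le : forall t : R, t \in `[t0, tf] -> opnorm (dB t) <= MdB.
Hypothesis phiP : is_transition_matrix A B t0 tf phi.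
Hypothesis theta_ge0 : forall s : R, 0 <= s -> 0 <= theta s.
Hypothesis phit_close : forall t s : R, t0 <= s -> s <= t -> t <= tf ->
  opnorm (phi t s - phit t s) <= theta (t - s).

Let U := zonotope c G.
Notation K := (set_norm U).

Variable Ct : R.
Hypothesis Ct_ge0 : 0 <= Ct.

Let L := tf - t0.
Let C1 := MA * expR MA.
Let Cr := MA ^+ 2 * expR MA.
Let Ca := Cr * K * ((MdB + MA * MB) / MA ^+ 2).
Let Cg := Cr * (1 + MdA / MA ^+ 2).
Let W := opnorm (row_mx c G).
Let M := expR (L * (C1 + 2 * Ct)) * (opnorm (row_mx a E) + L * (MB * W + Ca)).
Let Ce := expR (L * C1) * (L * (2 * (Ca + Ct * M))).
Let Cd := 2 * (C1 + Ct) * M + 2 * (MB * K) + Ca + MdB * K + (Cg + Ct) * M.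

Let nonneg : [/\ 0 <= MdA, 0 <= MB & 0 <= MdB] := bounds_ge0 t0_lt_tf dA_le B_le dB_le.
Let L_gt0 : 0 < L. Proof. by rewrite subr_gt0. Qed.
Let C1_ge0 : 0 <= C1. Proof. by rewrite mulr_ge0 ?expR_ge0 // ltW. Qed.
Let Cr_ge0 : 0 <= Cr. Proof. by rewrite mulr_ge0 ?expR_ge0 // exprn_ge0 // ltW. Qed.
Let K0 : 0 <= K := K_ge0 c G.

Let Ca_ge0 : 0 <= Ca.
Proof.
have [? ? ?] := nonneg; apply: mulr_ge0; first exact: mulr_ge0.
rewrite divr_ge0 ?exprn_ge0 ?(ltW MA_gt0) // addr_ge0 // mulr_ge0 //.
exact: ltW.
Qed.

Let Cg_ge0 : 0 <= Cg.
Proof.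
have [? ? ?] := nonneg; apply: mulr_ge0 => //.
by rewrite addr_ge0 // divr_ge0 // exprn_ge0 // ltW.
Qed.

Let M_ge0 : 0 <= M.
Proof.
have [? ? ?] := nonneg; rewrite mulr_ge0 ?expR_ge0 // addr_ge0 ?opnorm_ge0 //.
by rewrite mulr_ge0 ?(ltW L_gt0) // addr_ge0 // mulr_ge0 // opnorm_ge0.
Qed.

Section Grid.
Variable N : nat.
Hypothesis N_gt0 : (0 < N)%N.

Notation h := (step t0 tf N).
Notation nd := (node t0 tf N).
Notation bFi := (bF t0 tf B phit theta MA MB MdB U a E c G N).
Notation b_ i := (bFi i).1.
Notation F_ i := (bFi i).2.
Notation m_ := (m_norm t0 tf B phit theta MA MB MdB U a E c G N).
Notation Tr := (trans_step t0 tf phit N).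
Notation alpha := (aux_alpha MA MB MdB U).
Notation beta := (aux_beta MdB U).
Notation gamma := (aux_gamma MA MdA).

Hypothesis h_le1 : h <= 1.
Hypothesis theta_le : theta h <= Ct * h ^+ 2.

Let h_gt0 : 0 < h := step_gt0 t0_lt_tf N_gt0.
Let h0 : 0 <= h := ltW h_gt0.

Let hh : h ^+ 2 <= h.
Proof. by rewrite expr2 ler_piMl. Qed.

Let NhE i : (i <= N)%N -> i%:R * h <= L.
Proof.
move=> iN; have := node_le_tf t0_lt_tf N_gt0 iN.
by rewrite /node /L; lra.
Qed.

Let theta_leh : theta h <= Ct * h.
Proof. by apply: le_trans theta_le _; rewrite ler_wpM2l. Qed.

Let theta_h_ge0 : 0 <= theta h. Proof. exact: theta_ge0. Qed.

Let exp_le : expR (MA * h) - 1 <= C1 * h.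
Proof.
apply: le_trans (expR_sub1_le _) _; rewrite /C1 [leRHS]mulrAC.
apply: ler_wpM2l; first by rewrite mulr_ge0 // ltW.
by rewrite ler_expR ler_piMr // ltW.
Qed.

Let aux_r_le : aux_r MA h <= Cr * h ^+ 2.
Proof.
rewrite /aux_r; apply: le_trans (expR_taylor1_le _) _.
  by rewrite mulr_ge0 // ltW.
rewrite exprMn /Cr [leRHS](_ : _ = h ^+ 2 * MA ^+ 2 * expR MA); last by ring.
apply: ler_wpM2l; first by rewrite mulr_ge0 // exprn_ge0 // ltW.
by rewrite ler_expR ler_piMl // ltW.
Qed.

Let alpha_le : alpha h <= Ca * h ^+ 2.
Proof.
have [? ? ?] := nonneg.
rewrite /aux_alpha /Ca [leRHS](_ : _ = (Cr * h ^+ 2) * K * ((MdB + MA * MB) / MA ^+ 2)); last by ring.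
rewrite ler_wpM2r //.
  rewrite divr_ge0 ?exprn_ge0 ?(ltW MA_gt0) // addr_ge0 // mulr_ge0 //.
  exact: ltW.
by rewrite ler_wpM2r.
Qed.

Let alpha_ge0 : 0 <= alpha h.
Proof.
have [? ? ?] := nonneg; apply: mulr_ge0.
  by apply: mulr_ge0 => //; exact: aux_r_ge0.
rewrite divr_ge0 ?exprn_ge0 ?(ltW MA_gt0) // addr_ge0 // mulr_ge0 //.
exact: ltW.
Qed.

Let gamma_le : gamma h <= Cg * h ^+ 2.
Proof.
have [? ? ?] := nonneg.
rewrite /aux_gamma /Cg mulrAC ler_wpM2r //.
by rewrite addr_ge0 // divr_ge0 // exprn_ge0 // ltW.
Qed.

Let node_in i : (i < N)%N -> [/\ t0 <= nd i, nd i <= nd i.+1, nd i.+1 <= tf & nd i.+1 - nd i = h].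
Proof.
move=> iN; split; [exact: node_ge|exact: node_le|exact: node_le_tf|].
by rewrite nodeS addrC addKr.
Qed.

Let Tr_error i (v : 'cV[R]_n) : (i < N)%N ->
  `|phi (nd i.+1) (nd i) *m v - Tr i.+1 *m v| <= theta h * `|v|.
Proof.
move=> iN; have [H1 H2 H3 H4] := node_in iN.
by have := phit_close_mul phit_close v H1 H2 H3; rewrite H4.
Qed.

Let phi_step i (v : 'cV[R]_n) : (i < N)%N ->
  `|phi (nd i.+1) (nd i) *m v| <= (1 + C1 * h) * `|v|.
Proof.
move=> iN; have [H1 H2 H3 H4] := node_in iN.
apply: le_trans (phi_bound MA_gt0 A_le phiP v H1 H2 H3) _.
rewrite H4 mulrC ler_wpM2r //; have := exp_le; lra.
Qed.

Let Tr_step i (v : 'cV[R]_n) : (i < N)%N ->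
  `|Tr i.+1 *m v| <= (1 + C1 * h + theta h) * `|v|.
Proof.
move=> iN; have -> : Tr i.+1 *m v = phi (nd i.+1) (nd i) *m v
    - (phi (nd i.+1) (nd i) *m v - Tr i.+1 *m v) by rewrite opprB addrC subrK.
apply: le_trans (ler_normB _ _) _; rewrite [leRHS]mulrDl.
by apply: lerD; [exact: phi_step | exact: Tr_error].
Qed.

Let Tr_near_id i (v : 'cV[R]_n) : (i < N)%N ->
  `|Tr i.+1 *m v - v| <= (C1 + Ct) * h * `|v|.
Proof.
move=> iN; have [H1 H2 H3 H4] := node_in iN; have H0 := le_trans H2 H3.
have -> : Tr i.+1 *m v - v = (phi (nd i.+1) (nd i) *m v - v)
    - (phi (nd i.+1) (nd i) *m v - Tr i.+1 *m v).
  by rewrite opprB [RHS]addrC [RHS]addrA subrK.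
apply: le_trans (ler_normB _ _) _; rewrite !mulrDl; apply: lerD.
  have := phi_incr MA_gt0 A_le phiP v H1 (lexx _) H2 H3.
  rewrite (phi_id phiP) // subrr mulr0 expR0 H4 => /le_trans; apply.
  by rewrite mulrC ler_wpM2r.
by apply: le_trans (Tr_error v iN) _; rewrite ler_wpM2r.
Qed.

Let B_step i (w : 'cV[R]_m) : (i < N)%N ->
  `|h *: (B (nd i.+1) *m w)| <= h * (MB * `|w|).
Proof.
move=> iN; have [H1 H2 H3 H4] := node_in iN.
rewrite normrZ ger0_norm // ler_wpM2l //; apply: (B_mul_le B_le) => //.
exact: le_trans H2.
Qed.

Lemma m_norm_step i : (i < N)%N ->
  m_ i.+1 <= (1 + (C1 + 2 * Ct) * h) * m_ i + h * (MB * W + Ca).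
Proof.
move=> iN; have [? MB0 ?] := nonneg; have mi0 : 0 <= m_ i := opnorm_ge0 _.
set s := alpha h + theta h * m_ i.
have s0 : 0 <= s by rewrite addr_ge0 // mulr_ge0.
apply: (@le_trans _ _ ((1 + C1 * h + theta h) * m_ i + h * (MB * W) + s)).
  rewrite {1}/m_norm bF_S /= -/s.
  apply: opnorm_le.
    rewrite addr_ge0 // addr_ge0 //; first by rewrite mulr_ge0 // !addr_ge0 // mulr_ge0.
    by rewrite mulr_ge0 // mulr_ge0 // opnorm_ge0.
  move=> v; rewrite -[v]vsubmxK; set v0 := usubmx v.
  rewrite -[dsubmx v]vsubmxK; set v1 := usubmx (dsubmx v).
  rewrite -[dsubmx (dsubmx v)]vsubmxK; set v2 := usubmx _; set v3 := dsubmx _.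
  move=> /col_mx_norm_le1_inv[v01 /col_mx_norm_le1_inv[v11 /col_mx_norm_le1_inv[v21 v31]]].
  rewrite !mul_row_col.
  have -> : (Tr i.+1 *m b_ i + h *: (B (nd i.+1) *m c)) *m v0
      + (Tr i.+1 *m F_ i *m v1 + (K_mx t0 tf B G N i.+1 *m v2 + s%:M *m v3))
    = Tr i.+1 *m (row_mx (b_ i) (F_ i) *m col_mx v0 v1)
      + h *: (B (nd i.+1) *m (row_mx c G *m col_mx v0 v2)) + s *: v3.
    rewrite !mul_row_col !mulmxDr mulmxDl /K_mx -!scalemxAl scalerDr !mulmxA mul_scalar_mx.
    rewrite -!addrA; congr (_ + _); rewrite addrCA; congr (_ + _).
  apply: le_trans (ler_normD _ _) _; apply: lerD; last first.
    by rewrite normrZ ger0_norm // ler_piMr.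
  apply: le_trans (ler_normD _ _) _; apply: lerD.
    apply: le_trans (Tr_step _ iN) _; rewrite ler_wpM2l //.
      by rewrite !addr_ge0 // mulr_ge0.
    apply: le_trans (mulmx_norm_le _ _) _; rewrite ler_piMr ?opnorm_ge0 //.
    exact: col_mx_norm_le1.
  apply: le_trans (B_step _ iN) _; rewrite ler_wpM2l // ler_wpM2l //.
  apply: le_trans (mulmx_norm_le _ _) _; rewrite ler_piMr ?opnorm_ge0 //.
  exact: col_mx_norm_le1.
have H1 : theta h * m_ i <= Ct * h * m_ i by rewrite ler_wpM2r.
have H2 : alpha h <= Ca * h by apply: le_trans alpha_le _; rewrite ler_wpM2l.
by rewrite /s; lra.
Qed.

(** Uniform in N, since the growth factor per step is 1 + O(h). *)
Lemma m_norm_bounded i : (i <= N)%N -> m_ i <= M.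
Proof.
move=> iN; have [? MB0 ?] := nonneg.
have b0 : 0 <= MB * W + Ca by rewrite addr_ge0 // mulr_ge0 // opnorm_ge0.
have a0 : 0 <= C1 + 2 * Ct by rewrite addr_ge0 // mulr_ge0.
have := @discrete_gronwall R N m_ ((C1 + 2 * Ct) * h) (h * (MB * W + Ca))
  (mulr_ge0 a0 h0) (mulr_ge0 h0 b0) (opnorm_ge0 _) m_norm_step i iN.
move=> /le_trans; apply; rewrite /M; apply: ler_pM.
- exact: expR_ge0.
- by rewrite addr_ge0 ?opnorm_ge0 // mulr_ge0 // mulr_ge0.
- by rewrite ler_expR mulrCA mulrC ler_wpM2r // NhE.
- by rewrite lerD2l mulrA ler_wpM2r // NhE.
Qed.

(** The generator coordinates of the point are read as an initial state and as the
    values of a piecewise constant input; a step then adds an error of order h^2,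
    and these errors accumulate to order h. *)
Lemma node_point_tracked (sol : 'cV[R]_n -> (nat -> 'cV[R]_m) -> R -> 'cV[R]_n) :
  (forall x0 v, is_solution A B t0 tf t0 x0 (pw_input t0 tf N v) (sol x0 v)) ->
  (forall x0 v v' i, (forall k, (k < i)%N -> v k = v' k) ->
     sol x0 v (nd i) = sol x0 v' (nd i)) ->
  forall i, (i <= N)%N -> forall z : 'cV[R]_(F_cols i), `|z| <= 1 ->
  exists x0 v, [/\ zonotope a E x0, (forall k, U (v k)) &
    `|sol x0 v (nd i) - (b_ i + F_ i *m z)| <=
      expR (i%:R * (C1 * h)) * (i%:R * (2 * (Ca + Ct * M) * h ^+ 2))].
Proof.
move=> solP sol_causal.
(* Besides the propagated error, a step costs alpha for freezing B and theta m
   for replacing phi, and the same amount again for the box generator. *)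
pose e := fix e i : R := if i is j.+1 then (1 + C1 * h) * e j + 2 * (Ca + Ct * M) * h ^+ 2 else 0.
suff H i : (i <= N)%N -> forall z : 'cV[R]_(F_cols i), `|z| <= 1 ->
  exists x0 v, [/\ zonotope a E x0, (forall k, U (v k)) &
    `|sol x0 v (nd i) - (b_ i + F_ i *m z)| <= e i].
  move=> i iN z z1; have [x0 [v [x0E vU le]]] := H i iN z z1.
  exists x0, v; split=> //; apply: le_trans le _.
  have := @discrete_gronwall R N e (C1 * h) (2 * (Ca + Ct * M) * h ^+ 2).
  move=> /(_ _ _ _ _ i iN); rewrite [e 0%N]/= add0r; apply => //; first exact: mulr_ge0.
  by rewrite mulr_ge0 ?exprn_ge0 // mulr_ge0 // addr_ge0 // mulr_ge0.
have cU : U c by apply/zonotopeP; exists 0; rewrite ?normr0 // mulmx0 addr0.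
elim: i => [_ z z1|i IH iN z].
  exists (a + E *m z), (fun=> c); split=> //; first by apply/zonotopeP; exists z.
  have [_ xt0 _] := solP (a + E *m z) (fun=> c).
  by rewrite node0 xt0 /= subrr normr0.
rewrite /= in z *; rewrite -[z]vsubmxK; set z1 := usubmx z.
rewrite -[dsubmx z]vsubmxK; set xi := usubmx _; set zeta := dsubmx _.
move=> /col_mx_norm_le1_inv[z11 /col_mx_norm_le1_inv[xi1 zeta1]].
have [x0 [v [x0E vU le]]] := IH (ltnW iN) z1 z11.
pose w := c + G *m xi; have wU : U w by apply/zonotopeP; exists xi.
pose v' k := if (k < i)%N then v k else w.
exists x0, v'; split=> //; first by move=> k; rewrite /v'; case: ifP.
have [H1 H2 H3 H4] := node_in iN.
have XE : sol x0 v (nd i) = sol x0 v' (nd i).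
  by apply: sol_causal => k ki; rewrite /v' ki.
rewrite XE in le; have solv' := solP x0 v'; set X := sol x0 v' in le solv' *.
have [D nD HD] := solution_deriv solv'.
have nD' : (@lebesgue_measure R).-negligible (D `|` [set nd i.+1]).
  apply: negligibleU => //; apply/negligibleP => //.
  exact: lebesgue_measure_set1.
(* The input is constant on the cell except at its right end point, which is
   added to the exceptional set; the generator matrix is empty here. *)
have [||||eta _] := @input_estimate R n m t0 tf A dA B dB MA MdA MB MdB phi t0_lt_tf
  B_C1 MA_gt0 A_le dA_le B_le dB_le phiP 0 w 0 K (nd i) (nd i.+1) (nd i.+1)
  (D `|` [set nd i.+1]) (fun=> w) X H1 H2 (lexx _) H3 _ _ nD'.
- move=> y /zonotopeP[y' _ ->]; rewrite mul0mx addr0.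
  exact: zonotope_set_norm wU.
- by case: solv' => + _ _; apply: ac_sub.
- move=> t _ _; apply/zonotopeP; exists 0; first by rewrite normr0.
  by rewrite mulmx0 addr0.
- move=> t it ti /not_orP[nDt nti].
  have ti' : t < nd i.+1 by rewrite lt_neqAle ti andbT; apply/eqP.
  have -> : w = pw_input t0 tf N v' t.
    by rewrite (pw_input_eq t0_lt_tf N_gt0 v' it ti') /v' ltnn.
  by apply: HD => //; [exact: le_trans it|exact: le_trans ti _].
rewrite mul0mx addr0 subrr !mul0r addr0 H4 => HX.
set P := b_ i + F_ i *m z1 in le *.
have PM : `|P| <= M.
  by apply: (@le_trans _ _ (m_ i)); [exact: bF_point_norm|exact: m_norm_bounded (ltnW iN)].
set s := alpha h + theta h * m_ i.
have tM : theta h * m_ i <= Ct * M * h ^+ 2.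
  rewrite mulrAC; apply: ler_pM => //; first exact: opnorm_ge0.
  exact: m_norm_bounded (ltnW iN).
have s0 : 0 <= s by rewrite addr_ge0 // mulr_ge0 // opnorm_ge0.
have -> : (let (b, F) := bFi i in
  (Tr i.+1 *m b + h *: (B (nd i.+1) *m c), row_mx (Tr i.+1 *m F)
    (row_mx (K_mx t0 tf B G N i.+1) (alpha h + theta h * opnorm (row_mx b F))%:M))) = bFi i.+1.
  by [].
rewrite bF_S /= -/s !mul_row_col.
rewrite [X in `|X|](_ : _ = (X (nd i.+1) - phi (nd i.+1) (nd i) *m X (nd i)
    - h *: (B (nd i.+1) *m w))
  + phi (nd i.+1) (nd i) *m (X (nd i) - P)
  + (phi (nd i.+1) (nd i) *m P - Tr i.+1 *m P) - s *: zeta); last first.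
  rewrite /w /P /K_mx -!scalemxAl mul_scalar_mx !(mulmxBr, mulmxDr) !mulmxA scalerDr.
  move: (Tr i.+1 *m b_ i) (Tr i.+1 *m F_ i *m z1) (B _ *m c) (B _ *m G *m xi).
  move: (phi _ _ *m b_ i) (phi _ _ *m F_ i *m z1) (phi _ _ *m X _) (X _).
  by move=> y1 y2 y3 y4 y5 y6 y7 y8; apply/matrixP => k l; rewrite !mxE; ring.
apply: le_trans (ler_normB _ _) _.
apply: le_trans (lerD (ler_normD _ _) (lexx _)) _.
apply: le_trans (lerD (lerD (ler_normD _ _) (lexx _)) (lexx _)) _.
have G1 := phi_step (X (nd i) - P) iN.
have G2 : `|phi (nd i.+1) (nd i) *m P - Tr i.+1 *m P| <= Ct * M * h ^+ 2.
  apply: le_trans (Tr_error P iN) _; rewrite mulrAC.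
  by apply: ler_pM.
have G3 : `|s *: zeta| <= s by rewrite normrZ ger0_norm // ler_piMr.
have G4 : (1 + C1 * h) * `|X (nd i) - P| <= (1 + C1 * h) * e i.
  by rewrite ler_wpM2l // addr_ge0 // mulr_ge0.
have := alpha_le; rewrite -/(e i.+1).
move: HX G1 G2 G3 G4; rewrite /s -/(aux_alpha MA MB MdB U h) /=.
move: (`|_|) (`|_|) (`|_|) (`|_|) => *; lra.
Qed.

(** Since phit over one step is the identity up to O(h), the first block of
    generators of the enclosure is F_ i up to O(h), and all others are O(h). *)
Lemma Lambda_near i y : (i < N)%N ->
  Lambda t0 tf B phit theta MA MdA MB MdB U a E c G N i.+1 y ->
  exists2 z : 'cV[R]_(F_cols i), `|z| <= 1 & `|y - (b_ i + F_ i *m z)| <= Cd * h.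
Proof.
move=> iN; rewrite /Lambda /H_mx => /zonotopeP[x + ->].
have [? MB0 ?] := nonneg.
rewrite -[x]vsubmxK; set xJ := usubmx x; set x' := dsubmx x.
rewrite -[xJ]vsubmxK; set z1 := usubmx xJ; rewrite -[dsubmx xJ]vsubmxK.
set mu := usubmx _; set z2 := dsubmx _.
rewrite -[x']vsubmxK; set z3 := usubmx x'; set z4 := dsubmx x'.
move=> /col_mx_norm_le1_inv[/col_mx_norm_le1_inv[z11 /col_mx_norm_le1_inv[mu1 z21]]].
move=> /col_mx_norm_le1_inv[z31 z41].
exists z1 => //.
have mu11 : `|mu 0 0| <= 1 by apply: le_trans (cV_entry_le _ _) mu1.
have mM := m_norm_bounded (ltnW iN); have m0 : 0 <= m_ i := opnorm_ge0 _.
have bz (z : 'cV[R]_(F_cols i)) : `|z| <= 1 -> `|b_ i + F_ i *m z| <= M.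
  by move=> z_1; apply: le_trans mM; exact: bF_point_norm.
have Fz (z : 'cV[R]_(F_cols i)) : `|z| <= 1 -> `|F_ i *m z| <= M.
  move=> z_1; have -> : F_ i *m z = 2^-1 *: ((b_ i + F_ i *m z) - (b_ i + F_ i *m (- z))).
    by rewrite mulmxN -half_difference.
  rewrite normrZ ger0_norm ?invr_ge0 // ler_pdivrMl //.
  apply: le_trans (ler_normB _ _) _.
  have := bz z z_1; have := bz (- z); rewrite normrN => /(_ z_1); lra.
have bM : `|b_ i| <= M.
  by have := bz 0; rewrite normr0 mulmx0 addr0; apply.
have cK : `|c| <= K.
  by apply: zonotope_set_norm; apply/zonotopeP; exists 0; rewrite ?normr0 // mulmx0 addr0.
have GK : `|G *m z3| <= K.
  have -> : G *m z3 = 2^-1 *: ((c + G *m z3) - (c + G *m (- z3))).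
    by rewrite mulmxN -half_difference.
  rewrite normrZ ger0_norm ?invr_ge0 // ler_pdivrMl //.
  apply: le_trans (ler_normB _ _) _.
  have U1 : `|c + G *m z3| <= K by apply: zonotope_set_norm; apply/zonotopeP; exists z3.
  have U2 : `|c + G *m (- z3)| <= K.
    by apply: zonotope_set_norm; apply/zonotopeP; exists (- z3); rewrite ?normrN.
  by lra.
set s := _ + _ * m_norm _ _ _ _ _ _ _ _ _ _ _ _ _ _ _.
have {}sE : s = alpha h + beta h + (gamma h + theta h) * m_ i by [].
have g0 : 0 <= gamma h.
  by rewrite mulr_ge0 ?aux_r_ge0 // addr_ge0 // divr_ge0 // exprn_ge0 // ltW.
have s0 : 0 <= s.
  rewrite sE addr_ge0 //; last by rewrite mulr_ge0 // addr_ge0.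
  by rewrite addr_ge0 // mulr_ge0 // mulr_ge0 // exprn_ge0.
have sle : s <= (Ca + MdB * K + (Cg + Ct) * M) * h.
  rewrite sE !mulrDl; apply: lerD.
    apply: lerD; first by apply: le_trans alpha_le _; rewrite ler_wpM2l.
    by rewrite /aux_beta -mulrA mulrC ler_wpM2l // mulr_ge0.
  have gh : gamma h <= Cg * h by apply: le_trans gamma_le _; rewrite ler_wpM2l.
  rewrite [Cg * M * h]mulrAC [Ct * M * h]mulrAC.
  by apply: lerD; apply: ler_pM.
pose D1 := Tr i.+1 *m b_ i - b_ i + h *: (B (nd i.+1) *m c).
pose D2 (z : 'cV[R]_(F_cols i)) := Tr i.+1 *m (F_ i *m z) - F_ i *m z.
have HD1 : `|D1| <= (C1 + Ct) * h * M + h * (MB * K).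
  apply: le_trans (ler_normD _ _) _; apply: lerD.
    apply: le_trans (Tr_near_id _ iN) _; rewrite ler_wpM2l // mulr_ge0 //.
    exact: addr_ge0.
  by apply: le_trans (B_step _ iN) _; rewrite ler_wpM2l // ler_wpM2l.
have HD2 (z : 'cV[R]_(F_cols i)) : `|z| <= 1 -> `|D2 z| <= (C1 + Ct) * h * M.
  move=> z_1; apply: le_trans (Tr_near_id _ iN) _; rewrite ler_wpM2l ?Fz //.
  by rewrite mulr_ge0 // addr_ge0.
rewrite [X in `|X|](_ : _ = (2^-1 * (1 - mu 0 0)) *: D1 + 2^-1 *: D2 z1
   - 2^-1 *: D2 z2 + h *: (B (nd i.+1) *m (G *m z3)) + s *: z4); last first.
  rewrite /dJ enclosureE bF_S /= !mul_row_col /K_mx mul_scalar_mx -!scalemxAl.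
  rewrite [mu in LHS]mx11_scalar !mul_mx_scalar !mulmxDl !mulNmx -!mulmxA /D1 /D2.
  move: (Tr i.+1 *m b_ i) (Tr i.+1 *m (F_ i *m z1)) (Tr i.+1 *m (F_ i *m z2)).
  move: (F_ i *m z1) (F_ i *m z2) (B _ *m c) (B _ *m (G *m z3)).
  move=> y1 y2 y3 y4 y5 y6 y7; apply/matrixP => k l; rewrite !mxE.
  by field.
apply: le_trans (ler_normD _ _) _.
apply: le_trans (lerD (ler_normD _ _) (lexx _)) _.
apply: le_trans (lerD (lerD (ler_normB _ _) (lexx _)) (lexx _)) _.
apply: le_trans (lerD (lerD (lerD (ler_normD _ _) (lexx _)) (lexx _)) (lexx _)) _.
have E1 : `|(2^-1 * (1 - mu 0 0)) *: D1| <= `|D1|.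
  rewrite normrZ ler_piMl // normrM ger0_norm ?invr_ge0 // ler_pdivrMl //.
  by move: mu11; rewrite !ler_norml => /andP[? ?]; apply/andP; split; lra.
have E2 (z : 'cV[R]_(F_cols i)) : `|z| <= 1 -> `|2^-1 *: D2 z| <= 2^-1 * ((C1 + Ct) * h * M).
  by move=> z_1; rewrite normrZ ger0_norm ?invr_ge0 // ler_wpM2l ?invr_ge0 ?HD2.
have E3 : `|h *: (B (nd i.+1) *m (G *m z3))| <= h * (MB * K).
  by apply: le_trans (B_step _ iN) _; rewrite ler_wpM2l // ler_wpM2l.
have E4 : `|s *: z4| <= s by rewrite normrZ ger0_norm // ler_piMr.
have := E2 z1 z11; have := E2 z2 z21; rewrite /Cd.
by move: E1 HD1 E3 E4 sle; move: (`|_|) (`|_|) (`|_|) (`|_|) (`|_|) => *; lra.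
Qed.

End Grid.

(** The two gaps of order h add up: from a cell to its left node, and from the
    zonotope at this node to an exact trajectory. *)
Lemma R_hat_near_tube : exists2 C, 0 < C & forall N, (0 < N)%N ->
  step t0 tf N <= 1 -> theta (step t0 tf N) <= Ct * step t0 tf N ^+ 2 ->
  forall y, R_hat t0 tf B phit theta MA MdA MB MdB U a E c G N y ->
  exists2 y', reach_tube A B t0 (zonotope a E) U t0 tf y' &
    `|y - y'| <= C * step t0 tf N.
Proof.
have [? MB0 MdB0] := nonneg.
have Ce0 : 0 <= Ce.
  have ? : 0 <= Ca + Ct * M by rewrite addr_ge0 // mulr_ge0.
  by rewrite mulr_ge0 ?expR_ge0 // mulr_ge0 ?(ltW L_gt0) // mulr_ge0.
have Cd0 : 0 <= Cd.
  have a1 : 0 <= (C1 + Ct) * M by rewrite mulr_ge0 // addr_ge0.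
  have a2 : 0 <= (Cg + Ct) * M by rewrite mulr_ge0 // addr_ge0.
  have a3 : 0 <= MB * K by exact: mulr_ge0.
  have a4 : 0 <= MdB * K by exact: mulr_ge0.
  by rewrite /Cd; have := Ca_ge0; lra.
exists (Cd + Ce + 1); first by rewrite ltr_wpDl // addr_ge0.
move=> N N0 h1 hth y [i /= /andP[i0 iN] Ly].
case: i i0 iN Ly => // i _ iN Ly.
have [z z1 Hz] := Lambda_near N0 h1 hth iN Ly.
have [sol [solP sol_c]] := pw_solution t0_lt_tf A_C1 B_C1 MA_gt0 A_le dA_le B_le dB_le phiP N0.
have [x0 [v [x0E vU Hs]]] := node_point_tracked N0 h1 hth solP sol_c (ltnW iN) z1.
have h0 : 0 < step t0 tf N := step_gt0 t0_lt_tf N0.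
have NhE : i%:R * step t0 tf N <= L.
  have := node_le_tf t0_lt_tf N0 (ltnW iN); rewrite /node /L; lra.
exists (sol x0 v (node t0 tf N i)).
  have nt : node t0 tf N i <= tf := node_le_tf t0_lt_tf N0 (ltnW iN).
  exists (node t0 tf N i) => /=; first by rewrite in_itv /= node_ge.
  exists x0, (pw_input t0 tf N v), (sol x0 v); split=> //.
    exact: pw_input_admissible.
  have [ac x0v ae] := solP x0 v; split=> //; first exact: ac_sub ac.
  apply: negligibleS ae => t /=; apply: contra_not => H; rewrite in_itv /= => /andP[tt ti].
  by apply: H; rewrite in_itv /= tt (le_trans ti nt).
have -> : y - sol x0 v (node t0 tf N i) = (y - ((bF t0 tf B phit theta MA MB MdB U a E c G N i).1
    + (bF t0 tf B phit theta MA MB MdB U a E c G N i).2 *m z))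
  - (sol x0 v (node t0 tf N i) - ((bF t0 tf B phit theta MA MB MdB U a E c G N i).1
    + (bF t0 tf B phit theta MA MB MdB U a E c G N i).2 *m z)).
  by rewrite opprB addrA subrK.
apply: le_trans (ler_normB _ _) _; apply: le_trans (lerD Hz Hs) _.
have : expR (i%:R * (C1 * step t0 tf N)) * (i%:R * (2 * (Ca + Ct * M) * step t0 tf N ^+ 2))
    <= Ce * step t0 tf N.
  have s0 : 0 <= 2 * (Ca + Ct * M) by rewrite mulr_ge0 // addr_ge0 // mulr_ge0.
  rewrite /Ce -[leRHS]mulrA; apply: ler_pM.
  - exact: expR_ge0.
  - exact: mulr_ge0 (ler0n _ _) (mulr_ge0 s0 (sqr_ge0 _)).
  - by rewrite ler_expR mulrCA mulrC ler_wpM2r.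
  - rewrite [leLHS](_ : _ = i%:R * step t0 tf N * (2 * (Ca + Ct * M) * step t0 tf N)); last by ring.
    rewrite [leRHS](_ : _ = L * (2 * (Ca + Ct * M) * step t0 tf N)); last by ring.
    by rewrite ler_wpM2r // mulr_ge0 // ltW.
by have := ltW h0; lra.
Qed.

End Convergence.

(** * The Hausdorff distance *)

Section Hausdorff.
Context {R : realType}.

(** Since S is contained in T, only the distance of T from S matters. *)
Lemma hausdorff_dist_le n (S T : set 'cV[R]_n) (e : R) : 0 < e -> S `<=` T ->
  (forall y, T y -> exists2 y', S y' & `|y - y'| <= e) ->
  `|hausdorff_dist S T| <= e.
Proof.
move=> e0 ST near_S; set D := [set e | [/\ 0 < e, S `<=` fatten T e & T `<=` fatten S e]].
have De : D e.
  split=> // y.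
    move=> /ST Ty; exists y => //; exists 0; first by rewrite /unit_ball /= normr0.
    by rewrite scaler0 addr0.
  move=> /near_S[y' Sy' yy']; exists y' => //; exists (e^-1 *: (y - y')).
    by rewrite /unit_ball /= normrZ normfV gtr0_norm // ler_pdivrMl // mulr1.
  by rewrite scalerA divff ?gt_eqF // scale1r addrC subrK.
have D0 : lbound D 0 by move=> x [/ltW].
rewrite /hausdorff_dist -/D ger0_norm; first by apply: ge_inf => //; exists 0.
by apply: lb_le_inf => //; exists e.
Qed.

End Hausdorff.

Theorem mainTheorem4 (R : realType) (n m p q : nat)
    (n_gt0 : (0 < n)%N) (m_gt0 : (0 < m)%N)
    (t0 tf : R) (t0_lt_tf : t0 < tf)
    (* the system; dA and dB are the derivatives of A and B *)
    (A dA : R -> 'M[R]_n) (B dB : R -> 'M[R]_(n, m))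
    (A_C1 : C1_on t0 tf A dA) (B_C1 : C1_on t0 tf B dB)
    (MA MdA MB MdB : R) (MA_gt0 : 0 < MA)
    (A_le : forall t : R, t \in `[t0, tf] -> opnorm (A t) <= MA)
    (dA_le : forall t : R, t \in `[t0, tf] -> opnorm (dA t) <= MdA)
    (B_le : forall t : R, t \in `[t0, tf] -> opnorm (B t) <= MB)
    (dB_le : forall t : R, t \in `[t0, tf] -> opnorm (dB t) <= MdB)
    (* the transition matrix and its approximation *)
    (phi phit : R -> R -> 'M[R]_n) (theta : R -> R)
    (phiP : is_transition_matrix A B t0 tf phi)
    (theta_ge0 : forall s : R, 0 <= s -> 0 <= theta s)
    (theta_mono : forall s t : R, 0 <= s -> s <= t -> theta s <= theta t)
    (phit_close : forall t s : R, t0 <= s -> s <= t -> t <= tf ->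
      opnorm (phi t s - phit t s) <= theta (t - s))
    (theta_O : theta =O_ (0^'+) (fun h : R => h ^+ 2))
    (* the uncertainty sets *)
    (a : 'cV[R]_n) (E : 'M[R]_(n, p)) (c : 'cV[R]_m) (G : 'M[R]_(m, q))
    (X0 : set 'cV[R]_n) (U : set 'cV[R]_m)
    (X0E : X0 = zonotope a E) (UE : U = zonotope c G) :
  let tube := reach_tube A B t0 X0 U t0 tf in
  let Rhat := R_hat t0 tf B phit theta MA MdA MB MdB U a E c G in
  (forall N : nat, (0 < N)%N -> tube `<=` Rhat N) /\
  (fun N : nat => hausdorff_dist tube (Rhat N)) =O_\oo (fun N : nat => N%:R^-1 : R).
Proof.
move=> tube Rhat.
have sub N : (0 < N)%N -> tube `<=` Rhat N.
  move=> N0; rewrite /tube /Rhat X0E UE.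
  exact: (reach_tube_subset t0_lt_tf A_C1 B_C1 MA_gt0 A_le dA_le B_le dB_le phiP).
split=> //.
have /eqO_exP[k k0 [d /= d0 Hk]] := theta_O.
have [C C0 HC] := @R_hat_near_tube R n m p q t0 tf A dA B dB MA MdA MB MdB phi phit
  theta a E c G t0_lt_tf A_C1 B_C1 MA_gt0 A_le dA_le B_le dB_le phiP theta_ge0
  phit_close k (ltW k0).
have L0 : 0 < tf - t0 by rewrite subr_gt0.
apply/eqO_exP; exists (C * (tf - t0)); first exact: mulr_gt0.
(* From this index on the step is below 1 and below the radius d within which
   theta is dominated by k h^2. *)
pose d1 := Num.min d 1; have d10 : 0 < d1 by rewrite lt_min d0 ltr01.
exists (Num.truncn ((tf - t0) / d1)).+1 => // N /= NN.
have N0 : (0 < N)%N by exact: leq_trans NN.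
have NR : (0 : R) < N%:R by rewrite ltr0n.
have hd1 : step t0 tf N < d1.
  rewrite /step ltr_pdivrMr // mulrC -ltr_pdivrMr //.
  apply: lt_le_trans (truncnS_gt _) _; by rewrite ler_nat.
have h0 : 0 < step t0 tf N := step_gt0 t0_lt_tf N0.
move: hd1; rewrite lt_min => /andP[hd h1].
rewrite [`|N%:R^-1|]ger0_norm ?invr_ge0 // -mulrA.
apply: hausdorff_dist_le; first by rewrite mulr_gt0 // mulr_gt0 // invr_gt0.
  exact: sub.
rewrite /Rhat /tube X0E UE; apply: HC => //; first exact: ltW.
have := Hk (step t0 tf N); rewrite /= sub0r normrN gtr0_norm // => /(_ hd h0).
rewrite [`|_ ^+ 2|]ger0_norm ?exprn_ge0 ?(ltW h0) //.
by apply: le_trans; exact: ler_norm.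
Qed.
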